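(* Let $\mathbf b=(b_1,b_2,b_3,b_4)\in\mathbb{C}^4$ and let $\mathcal{M}_{\mathbf b}=\mathrm{Spec}\big(\mathbb{C}[x_1,x_2,x_3]/(u_4(\mathbf b))\big)$ be the relative $\mathrm{SL}(2,\mathbb{C})$-representation variety of the four-holed sphere with boundary traces $\mathbf b$. If $\mathcal{M}_{\mathbf b}$ is smooth, then its second algebraic de Rham cohomology $\mathrm{H}^2$ has dimension $h^2=5$ over $\mathbb{C}$, and the classes of the $2$-forms $$x_1\,dx_2\wedge dx_3,\quad x_1^2\,dx_2\wedge dx_3,\quad x_1x_2\,dx_2\wedge dx_3,\quad x_1x_3\,dx_2\wedge dx_3,\quad x_1^3\,dx_2\wedge dx_3$$ form a $\mathbb{C}$-basis of it.
   Context: Here $$u_4(\mathbf b) = 4-b_1^2-b_2^2-b_3^2-b_4^2-b_1b_2b_3b_4 + (b_1b_2+b_3b_4)x_1 + (b_1b_3+b_2b_4)x_2 + (b_2b_3+b_1b_4)x_3 - x_1^2-x_2^2-x_3^2 - x_1x_2x_3.$$ (The fundamental group is free on $F_1,F_2,F_3$, the punctures are $F_1,F_2,F_3,F_4=(F_1F_2F_3)^{-1}$, $b_i$ is the fixed value of $\mathrm{tr}\,\rho(F_i)$, and $x_1=\mathrm{tr}\,\rho(F_1F_2)$, $x_2=\mathrm{tr}\,\rho(F_1F_3)$, $x_3=\mathrm{tr}\,\rho(F_2F_3)$.) For an affine variety $U$ over $\mathbb{C}$, $(\Omega_U^\bullet,d)$ is its algebraic de Rham complex (global Kähler differential forms)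 with differentials $d_i:\Omega_U^i\to\Omega_U^{i+1}$, and $\mathrm{H}^i=\ker(d_i)/\mathrm{im}(d_{i-1})$, $h^i=\dim_{\mathbb{C}}\mathrm{H}^i$. *)

(* Defs.v *)
From HB Require Import structures.
From mathcomp Require Import all_boot all_algebra.
From mathcomp Require Import ring.
From mathcomp Require Import boolp reals complex mpoly freeg.

Set Implicit Arguments.
Unset Strict Implicit.
Unset Printing Implicit Defensive.

Import GRing.Theory.
Local Open Scope ring_scope.
Local Open Scope quotient_scope.

Record submodule (k : nzRingType) (V : lmodType k) := Submodule {
  submodule_pred :> {pred V};
  _ : submod_closed submodule_pred
}.

Lemma submodule_closed (k : nzRingType) (V : lmodType k) (W : submodule V) :
  submod_closed W.
Proof. by case: W. Qed.

HB.instance Definition _ (k : nzRingType) (V : lmodType k) (W : submodule V) :=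
  GRing.isSubmodClosed.Build k V (submodule_pred W) (submodule_closed W).

Section Basis.
Variables (k : nzRingType) (V : lmodType k).

Definition is_basis n (e : 'I_n -> V) : Prop :=
  (forall c : 'I_n -> k, \sum_i c i *: e i = 0 -> forall i, c i = 0) /\
  (forall v : V, exists c : 'I_n -> k, v = \sum_i c i *: e i).

Definition has_dim n : Prop := exists e : 'I_n -> V, is_basis e.

Definition lspan_pred (G : V -> Prop) : {pred V} :=
  fun x => `[< exists n (c : 'I_n -> k) (g : 'I_n -> V),
                 (forall i, G (g i)) /\ x = \sum_i c i *: g i >].

Lemma lspanP (G : V -> Prop) x :
  reflect (exists n (c : 'I_n -> k) (g : 'I_n -> V),
             (forall i, G (g i)) /\ x = \sum_i c i *: g i) (x \in lspan_pred G).
Proof. exact: asboolP. Qed.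

Lemma lspan_submod_closed G : submod_closed (lspan_pred G).
Proof.
split=> [|a x y].
  apply/lspanP; exists 0, (fun=> 0), (fun=> 0); split; first by case.
  by rewrite big_ord0.
move=> /lspanP[n [c [g [Gg ->]]]] /lspanP[m [d [h [Gh ->]]]].
apply/lspanP; exists (n + m)%N.
exists (fun i => match split i with inl i => a * c i | inr j => d j end).
exists (fun i => match split i with inl i => g i | inr j => h j end).
split; first by move=> i; case: (split i).
rewrite big_split_ord /= scaler_sumr; congr (_ + _); apply: eq_bigr => i _.
  by rewrite (unsplitK (inl i)) scalerA.
by rewrite (unsplitK (inr i)).
Qed.

Definition lspan G : submodule V := Submodule (@lspan_submod_closed G).

Lemma mem_lspan (G : V -> Prop) x : G x -> x \in lspan G.
Proof.
move=> Gx; apply/lspanP; exists 1%N, (fun=> 1), (fun=> x); split=> //.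
by rewrite big_ord1 scale1r.
Qed.

End Basis.

Section LmodQuotient.
Variables (k : nzRingType) (V : lmodType k) (W : submodule V).

Definition lquot := Quotient.quot (submodule_pred W).
HB.instance Definition _ := GRing.Zmodule.on lquot.
HB.instance Definition _ := Quotient.on lquot.

Definition lquot_pi (x : V) : lquot := \pi_(Quotient.quot (submodule_pred W)) x.

Lemma lquot_piP x y : reflect (lquot_pi x = lquot_pi y) (x - y \in W).
Proof. by rewrite Quotient.idealrBE; apply: eqP. Qed.

Lemma lquot_pi_zmod : zmod_morphism lquot_pi.
Proof. by move=> x y; rewrite /lquot_pi !piE. Qed.

Definition lquot_scale (c : k) (w : lquot) : lquot := lquot_pi (c *: repr w).

Lemma lquot_piK w : lquot_pi (repr w) = w.
Proof. exact: reprK. Qed.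

Lemma lquot_pi_repr x : repr (lquot_pi x) - x \in W.
Proof. by apply/lquot_piP; rewrite lquot_piK. Qed.

Lemma lquot_scale_pi c x : lquot_scale c (lquot_pi x) = lquot_pi (c *: x).
Proof. by apply/lquot_piP; rewrite -scalerBr rpredZ // lquot_pi_repr. Qed.

Lemma lquot_piD x y : lquot_pi (x + y) = lquot_pi x + lquot_pi y.
Proof. by rewrite /lquot_pi !piE. Qed.

Lemma lquot_scaleA a b w :
  lquot_scale a (lquot_scale b w) = lquot_scale (a * b) w.
Proof. by rewrite -[w]lquot_piK !lquot_scale_pi scalerA. Qed.

Lemma lquot_scale1 : left_id 1 lquot_scale.
Proof. by move=> w; rewrite -[w]lquot_piK lquot_scale_pi scale1r. Qed.

Lemma lquot_scaleDr : right_distributive lquot_scale +%R.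
Proof.
move=> c v w; rewrite -[v]lquot_piK -[w]lquot_piK -lquot_piD !lquot_scale_pi.
by rewrite scalerDr lquot_piD.
Qed.

Lemma lquot_scaleDl w : {morph lquot_scale^~ w : a b / a + b}.
Proof.
by move=> a b; rewrite -[w]lquot_piK !lquot_scale_pi scalerDl lquot_piD.
Qed.

HB.instance Definition _ := GRing.Zmodule_isLmodule.Build k lquot
  lquot_scaleA lquot_scale1 lquot_scaleDr lquot_scaleDl.

HB.instance Definition _ := GRing.isZmodMorphism.Build V lquot lquot_pi
  lquot_pi_zmod.

Lemma lquot_pi_scalable : scalable lquot_pi.
Proof. by move=> c x; rewrite -lquot_scale_pi. Qed.
HB.instance Definition _ := GRing.isScalable.Build k V lquot *:%R lquot_pi
  lquot_pi_scalable.

End LmodQuotient.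

Section AlgQuotient.
Variables (k : nzRingType) (P : comAlgType k) (I : idealr P).

Definition aquot := {ideal_quot I}.
HB.instance Definition _ := GRing.ComNzRing.on aquot.

Definition aquot_pi (x : P) : aquot := \pi_{ideal_quot I} x.

Lemma aquot_piP x y : reflect (aquot_pi x = aquot_pi y) (x - y \in I).
Proof. by rewrite Quotient.idealrBE; apply: eqP. Qed.

Lemma aquot_pi_zmod : zmod_morphism aquot_pi.
Proof. by move=> x y; rewrite /aquot_pi !piE. Qed.

Lemma aquot_pi_monoid : monoid_morphism aquot_pi.
Proof. by split=> [|x y]; rewrite /aquot_pi !piE. Qed.

HB.instance Definition _ := GRing.isZmodMorphism.Build P aquot aquot_pi
  aquot_pi_zmod.
HB.instance Definition _ := GRing.isMonoidMorphism.Build P aquot aquot_pi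
  aquot_pi_monoid.

Lemma aquot_piK w : aquot_pi (repr (w : {ideal_quot I})) = w.
Proof. exact: reprK. Qed.

Definition aquot_scale (c : k) (w : aquot) : aquot := aquot_pi c%:A * w.

Lemma aquot_scale_pi c x : aquot_scale c (aquot_pi x) = aquot_pi (c *: x).
Proof. by rewrite /aquot_scale -rmorphM -scalerAl mul1r. Qed.

Lemma aquot_scaleA a b w :
  aquot_scale a (aquot_scale b w) = aquot_scale (a * b) w.
Proof. by rewrite -[w]aquot_piK !aquot_scale_pi scalerA. Qed.

Lemma aquot_scale1 : left_id 1 aquot_scale.
Proof. by move=> w; rewrite -[w]aquot_piK aquot_scale_pi scale1r. Qed.

Lemma aquot_scaleDr : right_distributive aquot_scale +%R.
Proof. by move=> c v w; rewrite /aquot_scale mulrDr. Qed.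

Lemma aquot_scaleDl w : {morph aquot_scale^~ w : a b / a + b}.
Proof. by move=> a b; rewrite /aquot_scale scalerDl rmorphD mulrDl. Qed.

HB.instance Definition _ := GRing.Zmodule_isLmodule.Build k aquot
  aquot_scaleA aquot_scale1 aquot_scaleDr aquot_scaleDl.

Lemma aquot_scaleAl (c : k) (u v : aquot) : c *: (u * v) = (c *: u) * v.
Proof. exact: mulrA. Qed.

HB.instance Definition _ := GRing.Lmodule_isLalgebra.Build k aquot
  aquot_scaleAl.

Lemma aquot_scaleAr (c : k) (u v : aquot) : c *: (u * v) = u * (c *: v).
Proof. exact: mulrCA. Qed.

HB.instance Definition _ := GRing.Lalgebra_isAlgebra.Build k aquot
  aquot_scaleAr.

Lemma aquot_pi_scalable : scalable aquot_pi.
Proof. by move=> c x; rewrite -aquot_scale_pi. Qed.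
HB.instance Definition _ := GRing.isScalable.Build k P aquot *:%R aquot_pi
  aquot_pi_scalable.

End AlgQuotient.

Section DeRham.
Variables (k : comNzRingType) (A : comAlgType k).

(* s with its i-th entry replaced by b *)
Definition tupd p (s : p.-tuple A) (i : 'I_p) (b : A) : p.-tuple A :=
  [tuple if j == i then b else tnth s j | j < p].

(* The generator [(a, [:: s_1; ..; s_p])] stands for a ds_1 /\ .. /\ ds_p.    *)
Definition preform p := {freeg (A * p.-tuple A) / k}.
Definition gen p (a : A) (s : p.-tuple A) : preform p := << (a, s) >>.

(* Presentation of Lambda^p_A(Omega^1_{A/k}), where Omega^1_{A/k} is the      *)
(* A-module on the symbols db subject to d(b + c) = db + dc,                  *)
(* d(bc) = b dc + c db and dc = 0 for c in k.                                 *)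
Inductive form_rel p : preform p -> Prop :=
| RelCoefD a a' s : form_rel (gen (a + a') s - (gen a s + gen a' s))
| RelCoefZ c a s : form_rel (gen (c *: a) s - c *: gen a s)
| RelDiffD a s i b c :
    form_rel (gen a (tupd s i (b + c)) -
              (gen a (tupd s i b) + gen a (tupd s i c)))
| RelDiffM a s i b c :
    form_rel (gen a (tupd s i (b * c)) -
              (gen (a * b) (tupd s i c) + gen (a * c) (tupd s i b)))
| RelDiffC a s i c : form_rel (gen a (tupd s i c%:A))
| RelAlt a s i j : i != j -> tnth s i = tnth s j -> form_rel (gen a s).

Definition Omega p := lquot (lspan (@form_rel p)).
HB.instance Definition _ p := GRing.Lmodule.on (Omega p).
HB.instance Definition _ p := Quotient.on (Omega p).

Definition dform p (a : A) (s : p.-tuple A) : Omega p := lquot_pi _ (gen a s).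

Lemma lquot_pi_rel p x y : form_rel (x - y) ->
  lquot_pi (lspan (@form_rel p)) x = lquot_pi _ y.
Proof. by move=> r; apply/lquot_piP/mem_lspan. Qed.

Lemma formDl p a a' (s : p.-tuple A) : dform (a + a') s = dform a s + dform a' s.
Proof. by rewrite -lquot_piD; apply/lquot_pi_rel/RelCoefD. Qed.

Lemma formZl p c a (s : p.-tuple A) : dform (c *: a) s = c *: dform a s.
Proof.
rewrite /dform -linearZ; apply/lquot_pi_rel/RelCoefZ.
Qed.

Lemma formD p a (s : p.-tuple A) i b c :
  dform a (tupd s i (b + c)) = dform a (tupd s i b) + dform a (tupd s i c).
Proof. by rewrite -lquot_piD; apply/lquot_pi_rel/RelDiffD. Qed.

Lemma formM p a (s : p.-tuple A) i b c :
  dform a (tupd s i (b * c)) =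
  dform (a * b) (tupd s i c) + dform (a * c) (tupd s i b).
Proof. by rewrite -lquot_piD; apply/lquot_pi_rel/RelDiffM. Qed.

Lemma formC p a (s : p.-tuple A) i (c : k) : dform a (tupd s i c%:A) = 0.
Proof.
rewrite -[RHS](raddf0 (lquot_pi (lspan (@form_rel p)))).
by apply: lquot_pi_rel; rewrite subr0; apply: RelDiffC.
Qed.

Lemma form_alt p a (s : p.-tuple A) i j :
  i != j -> tnth s i = tnth s j -> dform a s = 0.
Proof.
move=> ij e; rewrite -[RHS](raddf0 (lquot_pi (lspan (@form_rel p)))).
by apply: lquot_pi_rel; rewrite subr0; apply: RelAlt ij e.
Qed.

Lemma tupdC p (s : p.-tuple A) i j b c : i != j ->
  tupd (tupd s i b) j c = tupd (tupd s j c) i b.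
Proof.
move=> ij; apply: eq_from_tnth => l; rewrite !tnth_mktuple.
by case: eqVneq => // ->; rewrite eq_sym (negPf ij).
Qed.

Lemma form_swap p a (s : p.-tuple A) i j b c : i != j ->
  dform a (tupd (tupd s i b) j c) = - dform a (tupd (tupd s i c) j b).
Proof.
move=> ij; apply/eqP; rewrite -addr_eq0; apply/eqP.
have alt x : dform a (tupd (tupd s i x) j x) = 0.
  apply: (form_alt a ij).
  by rewrite !tnth_mktuple !eqxx (negPf ij).
have := alt (b + c); rewrite formD.
by rewrite ![tupd (tupd s i (b + c)) j _]tupdC // !formD -!(tupdC _ _ _ ij) !alt
  add0r addr0 addrC.
Qed.

Lemma formZ p a (s : p.-tuple A) i (c : k) b :
  dform a (tupd s i (c *: b)) = c *: dform a (tupd s i b).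
Proof.
rewrite -[b in LHS]mul1r scalerAl formM -[X in _ = X]formZl.
by rewrite -scalerAr mulr1 formC addr0.
Qed.

Definition gen_d p (g : A * p.-tuple A) : Omega p.+1 :=
  dform 1 [tuple of g.1 :: g.2].

Definition pre_d p (x : preform p) : Omega p.+1 := fglift (@gen_d p) x.

Lemma pre_d_gen p a (s : p.-tuple A) :
  pre_d (gen a s) = dform 1 [tuple of a :: s].
Proof. by rewrite /pre_d liftU scale1r. Qed.

Lemma pre_d_zmod p : zmod_morphism (@pre_d p).
Proof. exact: lift_is_additive. Qed.
HB.instance Definition _ p :=
  GRing.isZmodMorphism.Build (preform p) (Omega p.+1) (@pre_d p) (@pre_d_zmod p).

Lemma pre_d_scalable p : scalable (@pre_d p).
Proof.
move=> c x; rewrite -[x]freeg_sumE scaler_sumr.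
rewrite raddf_sum raddf_sum scaler_sumr /=.
apply: eq_bigr => z _.
have -> : c *: << coeff z x *g z >> = << c * coeff z x *g z >> :> preform p.
  by apply/eqP/freeg_eqP => y; rewrite coeffZ !coeffU mulrA.
by rewrite /pre_d !liftU scalerA.
Qed.
HB.instance Definition _ p :=
  GRing.isScalable.Build k (preform p) (Omega p.+1) *:%R (@pre_d p)
    (@pre_d_scalable p).

Lemma cons_tupd0 p (s : p.-tuple A) a b :
  [tuple of a :: s] = tupd [tuple of b :: s] ord0 a.
Proof.
apply: eq_from_tnth => i; rewrite tnth_mktuple.
by case: (unliftP ord0 i) => [j|] ->; rewrite ?tnth0 ?tnthS ?eqxx.
Qed.

Lemma cons_tupd p (s : p.-tuple A) i a b :
  [tuple of a :: tupd s i b] = tupd [tuple of a :: s] (fintype.lift ord0 i) b.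
Proof.
apply: eq_from_tnth => l; rewrite tnth_mktuple.
case: (unliftP ord0 l) => [j|] ->; rewrite ?tnth0 ?tnthS //.
by rewrite tnth_mktuple (inj_eq lift_inj).
Qed.

Lemma pre_d_rel p (x : preform p) : form_rel x -> pre_d x = 0.
Proof.
case=> {x} [a a' s|c a s|a s i b c|a s i b c|a s i c|a s i j ij e].
- rewrite raddfB raddfD /= !pre_d_gen (cons_tupd0 s (a + a') 0).
  by rewrite (cons_tupd0 s a 0) (cons_tupd0 s a' 0) formD subrr.
- rewrite raddfB /= linearZ /= !pre_d_gen (cons_tupd0 s (c *: a) 0).
  by rewrite (cons_tupd0 s a 0) formZ subrr.
- by rewrite raddfB raddfD /= !pre_d_gen !cons_tupd formD subrr.
- rewrite raddfB raddfD /= !pre_d_gen !cons_tupd.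
  have ij := neq_lift ord0 i.
  rewrite formM !mul1r (cons_tupd0 s a 0) (cons_tupd0 s (a * b) 0).
  rewrite (cons_tupd0 s (a * c) 0) (tupdC _ (a * b) _ ij) (tupdC _ (a * c) _ ij).
  rewrite [dform 1 (tupd _ _ (a * b))]formM [dform 1 (tupd _ _ (a * c))]formM.
  rewrite !mul1r -!(tupdC _ _ _ ij).
  rewrite [dform a (tupd (tupd _ _ c) _ b)](form_swap _ _ _ _ ij).
  set x := dform b _; set y := dform c _; set z := dform a _.
  by apply/eqP; rewrite subr_eq0 addrACA subrr add0r.
- by rewrite pre_d_gen cons_tupd formC.
- by rewrite pre_d_gen; apply: (@form_alt _ _ _ (fintype.lift ord0 i) (fintype.lift ord0 j));
    rewrite ?(inj_eq lift_inj) // !tnthS.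
Qed.

(* The k-linear map sending a ds_1 /\ .. /\ ds_p to da /\ ds_1 /\ .. /\ ds_p,  *)
(* see dR_dform; it descends to the quotient by pre_d_rel.                     *)
Definition dR p (w : Omega p) : Omega p.+1 := pre_d (repr w).

Lemma dR_pi p (x : preform p) : dR (lquot_pi (lspan (@form_rel p)) x) = pre_d x.
Proof.
apply/eqP; rewrite -subr_eq0 -raddfB; apply/eqP.
have /lspanP[n [c [g [rg ->]]]] := lquot_pi_repr (lspan (@form_rel p)) x.
by rewrite raddf_sum big1 // => i _ /=; rewrite linearZ /= pre_d_rel // scaler0.
Qed.

Lemma dR_dform p a (s : p.-tuple A) : dR (dform a s) = dform 1 [tuple of a :: s].
Proof. by rewrite dR_pi pre_d_gen. Qed.

Lemma dR_linear p : linear (@dR p).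
Proof.
move=> c v w; rewrite -[v]lquot_piK -[w]lquot_piK -linearP !dR_pi.
exact: linearP.
Qed.
HB.instance Definition _ p :=
  GRing.isLinear.Build k (Omega p) (Omega p.+1) *:%R (@dR p) (@dR_linear p).

Lemma preform_ind p (Q : preform p -> Prop) :
  (forall a s, Q (gen a s)) -> (forall c x y, Q x -> Q y -> Q (c *: x + y)) ->
  forall x, Q x.
Proof.
move=> Qg Ql; have Q0 : Q 0.
  have [g _] : exists g : preform p, Q g by exists (gen 0 [tuple 0 | _ < p]).
  by have := Ql (-1) _ _ (Qg 0 [tuple 0 | _ < p]) (Qg 0 [tuple 0 | _ < p]);
    rewrite scaleN1r addNr.
elim/freeg_ind_dom0 => // c [a s] D _ _ QD.
have -> : << c *g (a, s) >> = c *: gen a s :> preform p; last exact: Ql.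
by apply/eqP/freeg_eqP => y; rewrite coeffZ !coeffU mul1r.
Qed.

Lemma dR_dR p (w : Omega p) : dR (dR w) = 0.
Proof.
rewrite -[w]lquot_piK; move: (repr w); apply: preform_ind => [a s|c x y Hx Hy].
  rewrite -/(dform a s) !dR_dform (cons_tupd0 [tuple of a :: s] _ 0).
  by rewrite -(scale1r 1) formC.
by rewrite !linearP /= Hx Hy scaler0 addr0.
Qed.

Definition closed_form p : {pred Omega p} := fun w => dR w == 0.
Arguments closed_form : clear implicits.

Lemma closed_formP p w : reflect (dR w = 0) (w \in closed_form p).
Proof. exact: eqP. Qed.

Lemma closed_form_submod_closed p : submod_closed (closed_form p).
Proof.
split=> [|c v w /closed_formP dv /closed_formP dw]; apply/closed_formP.
  exact: raddf0.
by rewrite linearP /= dv dw scaler0 addr0.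
Qed.
HB.instance Definition _ p := GRing.isSubmodClosed.Build k (Omega p)
  (closed_form p) (@closed_form_submod_closed p).

Record cocycle p := Cocycle {
  cocycle_form :> Omega p;
  _ : cocycle_form \in closed_form p
}.
HB.instance Definition _ p := [isSub for @cocycle_form p].
HB.instance Definition _ p := [Choice of cocycle p by <:].
HB.instance Definition _ p := [SubChoice_isSubLmodule of cocycle p by <:].

Definition exact_form p : {pred cocycle p} :=
  match p with
  | 0 => fun z => z == 0
  | q.+1 => fun z => `[< exists w : Omega q, cocycle_form z = dR w >]
  end.

Lemma exact_form_submod_closed p : submod_closed (@exact_form p).
Proof.
case: p => [|p].
  split=> [|c v w]; rewrite -!topredE /= ?eqxx //.
  by move=> /eqP-> /eqP->; rewrite scaler0 addr0.
split=> [|c v w /asboolP[v' ev] /asboolP[w' ew]]; apply/asboolP.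
  by exists 0; rewrite raddf0.
by exists (c *: v' + w'); rewrite linearP /= -ev -ew.
Qed.

Definition exact_submodule p := Submodule (@exact_form_submod_closed p).

(* ker(d : Omega p -> Omega p.+1) modulo the image of d : Omega p.-1 -> Omega p *)
Definition HdR p := lquot (exact_submodule p).
HB.instance Definition _ p := GRing.Lmodule.on (HdR p).

Definition HdR_class p (w : Omega p) (cw : w \in closed_form p) : HdR p :=
  lquot_pi (exact_submodule p) (Cocycle cw).

End DeRham.

Arguments closed_form {k} A p.

(* Jacobian criterion at the closed points: for K algebraically closed this   *)
(* is smoothness over K of the scheme Spec K[X_1, .., X_n]/(u).               *)
Definition smooth_hypersurface (K : closedFieldType) n (u : {mpoly K[n]}) : Prop :=
  forall v : 'I_n -> K, u.@[v] = 0 -> exists i : 'I_n, (u^`M(i)).@[v] != 0.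

Section FourHoledSphere.
Variable R : realType.
Local Notation C := R[i]%C.
Variables b1 b2 b3 b4 : C.

(* Variables are indexed from 0: x_1, x_2, x_3 are 'X_0, 'X_1, 'X_2.         *)
Local Notation X1 := ('X_(0 : 'I_3) : {mpoly C[3]}).
Local Notation X2 := ('X_(1 : 'I_3) : {mpoly C[3]}).
Local Notation X3 := ('X_(2 : 'I_3) : {mpoly C[3]}).

Definition u4 : {mpoly C[3]} :=
  (4 - b1 ^+ 2 - b2 ^+ 2 - b3 ^+ 2 - b4 ^+ 2 - b1 * b2 * b3 * b4)%:MP
  + (b1 * b2 + b3 * b4) *: X1
  + (b1 * b3 + b2 * b4) *: X2
  + (b2 * b3 + b1 * b4) *: X3
  - X1 ^+ 2 - X2 ^+ 2 - X3 ^+ 2 - X1 * X2 * X3.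

(* The principal ideal (u4); the library's quotient needs it to be proper.    *)
Definition u4_ideal : {pred {mpoly C[3]}} :=
  fun p => `[< exists q, p = q * u4 >].

Lemma u4_ideal_closed : idealr_closed u4_ideal.
Proof.
split.
- by apply/asboolP; exists 0; rewrite mul0r.
- apply/asboolP => -[q e].
  have [t ut] : exists t : C, u4.@[fun i => if i == 0 then t else 0] = 0.
    pose c i : C := if i == 0%N then 4 - b1 ^+ 2 - b2 ^+ 2 - b3 ^+ 2 - b4 ^+ 2
      - b1 * b2 * b3 * b4 else b1 * b2 + b3 * b4.
    have [t et] := @solve_monicpoly C 2%N c isT.
    exists t; rewrite /u4 !(mevalD, mevalN, mevalM, mevalZ, mevalXU, mevalC, rmorphXn) /=.
    move: et; rewrite !big_ord_recl big_ord0 /c /= expr0 expr1 mulr1 addr0 => et.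
    by rewrite -[t * t]/(t ^+ 2) et; ring.
  by have := congr1 (meval (fun i => if i == 0 then t else 0)) e;
    rewrite mevalM ut mulr0 meval1 => /eqP; rewrite oner_eq0.
- move=> a p q /asboolP[p' ->] /asboolP[q' ->]; apply/asboolP.
  by exists (a * p' + q'); rewrite mulrDl mulrA.
Qed.
HB.instance Definition _ := isIdealr.Build _ u4_ideal u4_ideal_closed.

(* M_b is affine and is represented by its coordinate ring. *)
Definition coordRing := aquot u4_ideal.
HB.instance Definition _ := GRing.ComAlgebra.on coordRing.

Definition x1 : coordRing := aquot_pi _ X1.
Definition x2 : coordRing := aquot_pi _ X2.
Definition x3 : coordRing := aquot_pi _ X3.

Definition fiveForms : 5.-tuple (Omega coordRing 2) :=
  [tuple dform x1 [tuple x2; x3];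
         dform (x1 ^+ 2) [tuple x2; x3];
         dform (x1 * x2) [tuple x2; x3];
         dform (x1 * x3) [tuple x2; x3];
         dform (x1 ^+ 3) [tuple x2; x3]].

End FourHoledSphere.

(* Main.v *)
Require Import Defs.
From HB Require Import structures.
From mathcomp Require Import all_boot all_algebra.
From mathcomp Require Import ring zify.
From mathcomp Require Import boolp reals complex mpoly freeg.

Set Implicit Arguments.
Unset Strict Implicit.
Unset Printing Implicit Defensive.

Import GRing.Theory Num.Theory.
Local Open Scope ring_scope.

(** Let F be the cubic, and write a vector field w = (a, b, c) with polynomial
    entries for the two-form a dy dz + b dz dx + c dx dy. Smoothness puts 1 in the ideal generated by F and
    its partial derivatives ([smooth_unit]); since dF = 0 on the surface, these
    kill the volume form, hence every two-form in the list is closed. The fields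
    which give the zero two-form on the surface are the F w and the q x grad F, and
    the exact two-forms come from the curls. As a polynomial field is a curl
    exactly when its divergence vanishes, the divergence identifies H^2 with the
    quotient of C[x, y, z] by

      D = { div(q x grad F) } + { div(F w) } = { grad F . curl q } + { div(F w) }

    ([two_form_span], [two_form_free]), and takes the five forms to
    1, 2x, y, z, 3x^2. It remains to show that these span a complement of D.

    For this, divide first by B = { grad F . curl q }. The quotient W is the
    Brieskorn module of F. It carries the multiplication T by F and the operator P
    which sends div w to grad F . w (the inverse of the Gauss-Manin connection);
    they satisfy T P = P T + P^2, and D / B = (T + P) W because
    div(F w) = F div w + grad F . w. The elements
    e = 1, x, y, z, x^2 - Ax - 2 (where 2A is the coefficient of x in F) form a
    basis of W over C[P]:
    - they generate, because every other monomial can be lowered in degree by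
      subtracting some grad F . w with div w of lower degree
      ([cubic_basis_gen]);
    - they are independent and P is injective, because they are independent in the
      Jacobian ring ([cubic_basis_free]) and the Koszul complex of grad F is exact
      ([cubic_koszul]).
    Finally T e_i = d_i P e_i modulo the span of e, with d = 1, 3/2, 3/2, 3/2, 2
    ([mul_cubic_basis]). By the commutation rule, T + P raises the degree in P by
    exactly one and multiplies the leading coefficient of P^k e_i by
    d_i + k + 1, which is not zero; so W is the direct sum of the span of e and
    (T + P) W ([comb_TP_complement], [comb_TP_span]). *)

(** * Operators with [T, P] = P^2 *)

Section WeylModule.
Variables (K : fieldType) (W : lmodType K) (P T : {linear W -> W}).
Variables (n : nat) (e : 'I_n -> W) (d : 'I_n -> K) (M : 'I_n -> 'I_n -> K).

Definition comb (c : 'I_n -> K) : W := \sum_i c i *: e i.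

Hypothesis TP : forall w, T (P w) = P (T w) + P (P w).
Hypothesis P_gen : forall Q : W -> Prop,
  (forall i, Q (e i)) -> (forall c v w, Q v -> Q w -> Q (c *: v + w)) ->
  (forall w, Q w -> Q (P w)) -> forall w, Q w.
Hypothesis P_free : forall c w,
  comb c + P w = 0 -> (forall i, c i = 0) /\ w = 0.
Hypothesis Te : forall i, T (e i) = comb (M i) + d i *: P (e i).
Hypothesis d_neq0 : forall i k, d i + k.+1%:R != 0.

Lemma combP a c c' : comb (fun i => a * c i + c' i) = a *: comb c + comb c'.
Proof.
rewrite /comb scaler_sumr -big_split; apply: eq_bigr => i _ /=.
by rewrite scalerDl scalerA.
Qed.

Lemma combD c c' : comb (fun i => c i + c' i) = comb c + comb c'.
Proof. by rewrite /comb -big_split; apply: eq_bigr => i _; rewrite scalerDl. Qed.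

Lemma comb0 : comb (fun=> 0) = 0.
Proof. by rewrite /comb big1 // => i _; rewrite scale0r. Qed.

Lemma comb_e i : comb (fun j => (j == i)%:R) = e i.
Proof.
rewrite /comb (bigD1 i) //= eqxx scale1r big1 ?addr0 // => j /negPf->.
by rewrite scale0r.
Qed.

Lemma iterPP k a v w : iter k P (a *: v + w) = a *: iter k P v + iter k P w.
Proof. by elim: k => //= k ->; rewrite linearP. Qed.

Lemma iterPD k v w : iter k P (v + w) = iter k P v + iter k P w.
Proof. by have := iterPP k 1 v w; rewrite !scale1r. Qed.

Lemma T_iterP k w : T (iter k P w) = iter k P (T w) + k%:R *: iter k.+1 P w.
Proof.
elim: k => [|k IHk]; first by rewrite scale0r addr0.
rewrite iterS TP IHk linearD linearZ /= -addrA; congr (_ + _).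
by rewrite -natr1 scalerDl scale1r.
Qed.

Definition row_comb (c : 'I_n -> K) i := \sum_j c j * M j i.

Lemma T_comb c : T (comb c) = comb (row_comb c) + P (comb (fun i => d i * c i)).
Proof.
rewrite {1}/comb linear_sum /=.
under eq_bigr do rewrite linearZ /= Te scalerDr.
rewrite big_split; congr (_ + _).
  rewrite /comb /row_comb.
  under eq_bigr do rewrite /comb scaler_sumr.
  rewrite exchange_big; apply: eq_bigr => i _ /=.
  by rewrite scaler_suml; apply: eq_bigr => j _; rewrite scalerA.
rewrite /comb linear_sum; apply: eq_bigr => i _.
by rewrite scalerA mulrC linearZ.
Qed.

(** Each commutation of T with P adds one to the coefficient d, so T + P raises
    the degree in P by exactly one. *)
Lemma TP_iterP k c : T (iter k P (comb c)) + P (iter k P (comb c)) =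
  iter k P (comb (row_comb c)) +
  iter k.+1 P (comb (fun i => (d i + k.+1%:R) * c i)).
Proof.
rewrite T_iterP T_comb iterPD -!addrA -iterSr; congr (_ + _).
rewrite -[P (iter k P _)]scale1r -iterS -scalerDl natr1 addrC -iterPP -combP.
by congr (iter _ _ _); apply: eq_bigr => i _; rewrite mulrDl addrC.
Qed.

Definition Psum m (c : nat -> 'I_n -> K) : W := \sum_(k < m) iter k P (comb (c k)).

Lemma PsumS m c : Psum m.+1 c = Psum m c + iter m P (comb (c m)).
Proof. exact: big_ord_recr. Qed.

Lemma PsumSl m c : Psum m.+1 c = comb (c 0) + P (Psum m (fun k => c k.+1)).
Proof. by rewrite /Psum big_ord_recl linear_sum. Qed.

Lemma PsumP m a c c' :
  Psum m (fun k i => a * c k i + c' k i) = a *: Psum m c + Psum m c'.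
Proof.
rewrite /Psum scaler_sumr -big_split; apply: eq_bigr => k _ /=.
by rewrite combP iterPP.
Qed.

Lemma PsumD m c c' : Psum m (fun k i => c k i + c' k i) = Psum m c + Psum m c'.
Proof.
rewrite /Psum -big_split; apply: eq_bigr => k _ /=.
by rewrite combD iterPD.
Qed.

Lemma Psum_pad m m' c : (m <= m')%N ->
  Psum m c = Psum m' (fun k i => if (k < m)%N then c k i else 0).
Proof.
move=> lem; rewrite /Psum (big_ord_widen m' (fun k => iter k P (comb (c k)))) //.
rewrite big_mkcond; apply: eq_bigr => k _; case: ifP => // _.
by rewrite comb0; elim: (k : nat) => //= j <-; rewrite linear0.
Qed.

Lemma Psum_gen w : exists m c, w = Psum m c.
Proof.
apply: (P_gen (Q := fun w => exists m c, w = Psum m c)) w.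
- move=> i; exists 1%N, (fun _ j => (j == i)%:R).
  by rewrite /Psum big_ord1 /= comb_e.
- move=> a v w [m [c ->]] [m' [c' ->]]; exists (maxn m m').
  rewrite (Psum_pad _ (leq_maxl m m')) (Psum_pad _ (leq_maxr m m')) -PsumP.
  by eexists.
- move=> w [m [c ->]]; exists m.+1, (fun k => if k is j.+1 then c j else fun=> 0).
  by rewrite PsumSl comb0 add0r.
Qed.

(** Freeness over the polynomials in P: the leading coefficient of a relation
    vanishes. *)
Lemma Psum_lead m c b :
  Psum m c + iter m P (comb b) = 0 -> forall i, b i = 0.
Proof.
elim: m c => [|m IHm] c.
  rewrite /Psum big_ord0 add0r => b0.
  by have /P_free[] : comb b + P 0 = 0 by rewrite linear0 addr0.
by rewrite PsumSl -addrA -linearD => /P_free[_]; apply: IHm.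
Qed.

(** The leading term of (T + P) h has positive degree in P as long as h is not
    zero, so a combination of the basis is never of this form. *)
Lemma comb_TP_complement c h : comb c = T h + P h -> forall i, c i = 0.
Proof.
have [m [c' ->]] := Psum_gen h; elim: m c' => [|m IHm] c'.
  rewrite /Psum big_ord0 !linear0 addr0 => e0.
  by have /P_free[] : comb c + P 0 = 0 by rewrite linear0 addr0.
have TPsum q : T (Psum q c') + P (Psum q c') =
    Psum q (fun k => row_comb (c' k)) +
    P (Psum q (fun k i => (d i + k.+1%:R) * c' k i)).
  rewrite /Psum !linear_sum -!big_split; apply: eq_bigr => k _ /=.
  exact: TP_iterP.
move=> e0; have c'm : forall i, (d i + m.+1%:R) * c' m i = 0.
  (* The term of index 0 in the second family moves the left-hand side over. *)
  apply: (@Psum_lead m.+1 (fun k i => row_comb (c' k) i +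
    if k is j.+1 then (d i + j.+1%:R) * c' j i else -1 * c i + 0)).
  rewrite PsumD [X in _ + X + _]PsumSl combP comb0 addr0 scaleN1r e0 TPsum.
  set x := Psum _ _; rewrite PsumS [P (_ + _)]linearD /=.
  by rewrite opprD !addrA subrr add0r -addrA addNr.
apply: (IHm c'); move: e0; rewrite PsumS.
suff -> : comb (c' m) = 0.
  have -> : iter m P 0 = 0 by elim: m {IHm c'm} => //= k ->; rewrite linear0.
  by rewrite addr0.
rewrite /comb big1 // => i _; move/eqP: (c'm i).
by rewrite mulf_eq0 (negPf (d_neq0 _ _)) => /eqP->; rewrite scale0r.
Qed.

(** A power P^{k+1} e is removed by (T + P) P^k e at the cost of terms of degree
    k in P. *)
Lemma comb_TP_span w : exists c h, w = comb c + (T h + P h).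
Proof.
pose U w := exists c h, w = comb c + (T h + P h).
have UD v1 v2 : U v1 -> U v2 -> U (v1 + v2).
  move=> [c [h ->]] [c' [h' ->]]; exists (fun i => c i + c' i), (h + h').
  by rewrite combD !linearD /= addrACA; congr (_ + _); rewrite addrACA.
have [m [c ->]] := Psum_gen w; rewrite -/(U _) /Psum.
apply: (big_ind U) => // [|k _].
  by exists (fun=> 0), 0; rewrite comb0 !linear0 !addr0.
elim: (k : nat) (c k) => {k} [|k IHk] b.
  by exists b, 0; rewrite !linear0 !addr0.
pose b' i := (d i + k.+1%:R)^-1 * b i.
have -> : iter k.+1 P (comb b) = - iter k P (comb (row_comb b')) +
    (T (iter k P (comb b')) + P (iter k P (comb b'))).
  rewrite TP_iterP addKr; congr (iter _ _ _); apply: eq_bigr => i _.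
  by rewrite mulVKf.
apply: UD; last by exists (fun=> 0), (iter k P (comb b')); rewrite comb0 add0r.
have [c' [h ->]] := IHk (row_comb b').
exists (fun i => -1 * c' i + 0), (- h).
by rewrite combP comb0 addr0 scaleN1r !linearN /= !opprD.
Qed.

End WeylModule.

(** * Vector calculus on affine three-space *)

Local Notation i1 := (0 : 'I_3).
Local Notation i2 := (1 : 'I_3).
Local Notation i3 := (2 : 'I_3).

Section PolyInduction.
Variables (n : nat) (R : comNzRingType).

Lemma mpoly_monom_ind (Q : {mpoly R[n]} -> Prop) :
  (forall m, Q 'X_[m]) -> (forall c p q, Q p -> Q q -> Q (c *: p + q)) ->
  forall p, Q p.
Proof.
move=> QX QP; have Q0 : Q 0.
  by have := QP (-1) _ _ (QX 0%MM) (QX 0%MM); rewrite scaleN1r addNr.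
by elim/mpolyind=> // c m p _ _; apply: QP.
Qed.

Lemma mpoly_alg_ind (Q : {mpoly R[n]} -> Prop) :
  (forall c, Q c%:MP) -> (forall i, Q 'X_i) ->
  (forall p q, Q p -> Q q -> Q (p + q)) -> (forall p q, Q p -> Q q -> Q (p * q)) ->
  forall p, Q p.
Proof.
move=> QC QX QD QM; apply: mpoly_monom_ind => [m|c p q Qp Qq].
  rewrite mpolyXE_id; apply: (big_ind Q) => [||i _]; rewrite -?mpolyC1 //.
  by elim: (m i) => [|k IHk]; rewrite ?expr0 -?mpolyC1 // exprS; apply: QM.
by rewrite -mul_mpolyC; apply: QD => //; apply: QM.
Qed.

Section LinearExtension.
Variables (W : lmodType R) (g : 'X_{1..n} -> W).

Definition mlift (p : {mpoly R[n]}) : W := \sum_(m <- msupp p) p@_m *: g m.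

Lemma mliftE p D : uniq D -> {subset msupp p <= D} ->
  mlift p = \sum_(m <- D) p@_m *: g m.
Proof.
move=> uD sD; rewrite [RHS](bigID (fun m => m \in msupp p)) /=.
rewrite [X in _ = _ + X]big1 ?addr0; last first.
  by move=> m /memN_msupp_eq0->; rewrite scale0r.
rewrite -big_filter; apply: perm_big; apply: uniq_perm; rewrite ?filter_uniq //.
by move=> m; rewrite mem_filter; case: (boolP (m \in msupp p)) => //= /sD->.
Qed.

Lemma mlift_linear : linear mlift.
Proof.
move=> a p q; pose D := undup (msupp (a *: p + q) ++ msupp p ++ msupp q).
have uD : uniq D by apply: undup_uniq.
have sD r : r \in [:: a *: p + q; p; q] -> {subset msupp r <= D}.
  by rewrite !inE => + m hm; rewrite mem_undup !mem_cat => /or3P[]/eqP<-; rewrite hm ?orbT.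
rewrite !(mliftE uD); try by apply: sD; rewrite !inE eqxx ?orbT.
rewrite scaler_sumr -big_split; apply: eq_bigr => m _ /=.
by rewrite mcoeffD mcoeffZ scalerDl scalerA.
Qed.

Lemma mliftX m : mlift 'X_[m] = g m.
Proof. by rewrite /mlift msuppX big_seq1 mcoeffX eqxx scale1r. Qed.

End LinearExtension.

End PolyInduction.

Section Calculus.
Variable K : numFieldType.
Local Notation P := {mpoly K[3]}.
Implicit Types (p q a b c u v w : P) (i j : 'I_3).

Lemma mulC_natV n : n.+1%:R * (n.+1%:R^-1)%:MP = 1 :> P.
Proof. by rewrite -mpolyC_nat -mpolyCM mulfV ?pnatr_eq0 // mpolyC1. Qed.

Lemma mderivXU i j : ('X_i : P)^`M(j) = (i == j)%:R%:MP.
Proof.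
rewrite mderivX mnm1E; case: eqVneq => [->|_]; last by rewrite scale0r.
by rewrite -[X in (X - _)%MM]add0m addmK mpolyX0 scale1r mpolyC1.
Qed.

Lemma mderivXn i j k : ('X_i ^+ k : P)^`M(j) = ((i == j) * k)%:R * 'X_i ^+ k.-1.
Proof.
elim: k => [|k IHk]; first by rewrite expr0 -mpolyC1 mderivC muln0 mul0r.
rewrite exprS mderivM IHk mderivXU mpolyC_nat.
case: (i == j); last by rewrite !mul0r mulr0 addr0.
by case: k {IHk} => [|k]; rewrite /= ?expr0 ?exprS !mul1n; ring.
Qed.

(** The primitive in the i-th variable which vanishes where this variable does. *)
Definition integ i : P -> P := mlift (fun m => (m i).+1%:R^-1 *: 'X_[m + U_(i)]).
HB.instance Definition _ i :=
  GRing.isLinear.Build K P P *:%R (integ i) (mlift_linear _).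

Lemma integX i m : integ i 'X_[m] = (m i).+1%:R^-1 *: 'X_[m + U_(i)].
Proof. exact: mliftX. Qed.

Lemma deriv_integ i p : (integ i p)^`M(i) = p.
Proof.
elim/mpoly_monom_ind: p => [m|a p q IHp IHq]; last first.
  by rewrite linearP mderivD mderivZ IHp IHq.
rewrite integX mderivZ mderivX scalerA mnmDE mnm1E eqxx addn1 mulVf ?pnatr_eq0 //.
by rewrite addmK scale1r.
Qed.

Lemma deriv_integC i j p : i != j -> (integ i p)^`M(j) = integ i p^`M(j).
Proof.
move=> ij; elim/mpoly_monom_ind: p => [m|a p q IHp IHq]; last first.
  by rewrite linearP mderivD !mderivZ IHp IHq mderivD mderivZ linearP.
rewrite integX mderivZ !mderivX [integ i (_ *: _)]linearZ /= integX !scalerA.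
rewrite mnmDE mnm1E (negPf ij) addn0.
rewrite mulrC mnmBE mnm1E [j == i]eq_sym (negPf ij) subn0.
case: (posnP (m j)) => [->|mj]; first by rewrite !mul0r !scale0r.
congr (_ *: 'X_[_]); apply/mnmP=> l; rewrite !(mnmBE, mnmDE, mnm1E).
case: eqVneq => [e|_]; case: eqVneq => [e'|_]; rewrite ?subn0 ?addn0 ?addn1 ?subn1 //.
by rewrite e e' eqxx in ij.
Qed.

Definition div a b c : P := a^`M(i1) + b^`M(i2) + c^`M(i3).

Lemma integ_deriv0 i j p : i != j -> p^`M(i) = 0 -> (integ j p)^`M(i) = 0.
Proof. by move=> ij p0; rewrite deriv_integC 1?eq_sym // p0 linear0. Qed.

(** The Poincare lemma for polynomial two-forms. Integration of b and c along x
    reduces to a field (a0, 0, 0) with a0 free of x, which is a curl by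
    integration along y. *)
Lemma div0_curl a b c : div a b c = 0 -> exists u v w,
  [/\ a = w^`M(i2) - v^`M(i3), b = u^`M(i3) - w^`M(i1) & c = v^`M(i1) - u^`M(i2)].
Proof.
rewrite /div => abc.
pose a0 := a + integ i1 (b^`M(i2)) + integ i1 (c^`M(i3)).
have a00 : a0^`M(i1) = 0 by rewrite /a0 !mderivD !deriv_integ.
exists 0, (integ i1 c), (integ i2 a0 - integ i1 b); split.
- rewrite mderivB deriv_integ !deriv_integC // /a0.
  by ring.
- by rewrite mderiv0 mderivB deriv_integ integ_deriv0 // !sub0r opprK.
- by rewrite mderiv0 subr0 deriv_integ.
Qed.

End Calculus.

(** * The Brieskorn module of a polynomial in three variables *)

Section Brieskorn.
Variable K : numFieldType.
Local Notation P := {mpoly K[3]}.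
Variable F : P.
Local Notation Fx := F^`M(i1).
Local Notation Fy := F^`M(i2).
Local Notation Fz := F^`M(i3).
Implicit Types (p q a b c u v w : P).

Definition along a b c : P := Fx * a + Fy * b + Fz * c.

Definition curl_along u v w : P :=
  along (w^`M(i2) - v^`M(i3)) (u^`M(i3) - w^`M(i1)) (v^`M(i1) - u^`M(i2)).

Lemma div_cross u v w :
  div (v * Fz - w * Fy) (w * Fx - u * Fz) (u * Fy - v * Fx) = curl_along u v w.
Proof.
rewrite /div /curl_along /along !mderivB !mderivM.
by rewrite (mderiv_comm i1 i2) (mderiv_comm i1 i3) (mderiv_comm i2 i3); ring.
Qed.

Lemma div_mulF a b c : div (F * a) (F * b) (F * c) = F * div a b c + along a b c.
Proof. by rewrite /div /along !mderivM; ring. Qed.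

Lemma divP (k : K) a b c a' b' c' :
  div (k *: a + a') (k *: b + b') (k *: c + c') = k *: div a b c + div a' b' c'.
Proof. by rewrite /div !mderivD !mderivZ -!mul_mpolyC; ring. Qed.

Lemma alongP (k : K) a b c a' b' c' :
  along (k *: a + a') (k *: b + b') (k *: c + c') = k *: along a b c + along a' b' c'.
Proof. by rewrite /along -!mul_mpolyC; ring. Qed.

Lemma curl_alongP (k : K) u v w u' v' w' :
  curl_along (k *: u + u') (k *: v + v') (k *: w + w') =
  k *: curl_along u v w + curl_along u' v' w'.
Proof. by rewrite /curl_along /along !mderivD !mderivZ -!mul_mpolyC; ring. Qed.

Lemma div_integ p : div (integ i1 p) 0 0 = p.
Proof. by rewrite /div deriv_integ !mderiv0 !addr0. Qed.

Definition brieskorn_pred : {pred P} := fun p => `[< exists u v w, p = curl_along u v w >].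

Lemma brieskorn_closed : submod_closed brieskorn_pred.
Proof.
split=> [|k p q /asboolP[u [v [w ->]]] /asboolP[u' [v' [w' ->]]]]; apply/asboolP.
  by exists 0, 0, 0; rewrite /curl_along /along !mderiv0 !subr0 !mulr0 !addr0.
by exists (k *: u + u'), (k *: v + v'), (k *: w + w'); rewrite curl_alongP.
Qed.

Definition brieskorn := lquot (Submodule brieskorn_closed).
HB.instance Definition _ := GRing.Lmodule.on brieskorn.

Definition bclass : {linear P -> brieskorn} := lquot_pi (Submodule brieskorn_closed).

Lemma bclassP p q :
  bclass p = bclass q <-> exists u v w, p - q = curl_along u v w.
Proof.
split=> [/lquot_piP/asboolP //|h]; first by apply/lquot_piP/asboolP.
Qed.

Lemma bclass_repr p : exists u v w, repr (bclass p : brieskorn) - p = curl_along u v w.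
Proof. by have /asboolP := lquot_pi_repr (Submodule brieskorn_closed) p. Qed.

Lemma bclassK h : bclass (repr (h : brieskorn)) = h.
Proof. exact: lquot_piK. Qed.

(** The operator which sends div w to grad F . w, here for the field w along the
    first axis; [primitive_div] shows that the choice of w is irrelevant. *)
Definition primitive (h : brieskorn) : brieskorn := bclass (along (integ i1 (repr h)) 0 0).
Definition mulF (h : brieskorn) : brieskorn := bclass (F * repr h).

(** Two fields with the same divergence modulo grad F . curl q = div(q x grad F)
    differ by some q x grad F, which grad F kills, and a curl. *)
Lemma primitive_div a b c : primitive (bclass (div a b c)) = bclass (along a b c).
Proof.
rewrite /primitive; set p := repr _.
have [u [v [w E]]] := bclass_repr (div a b c); rewrite -/p in E.
have [|u' [v' [w' [ea eb ec]]]] := @div0_curl K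
  (integ i1 p - a - (v * Fz - w * Fy)) (- b - (w * Fx - u * Fz))
  (- c - (u * Fy - v * Fx)).
  rewrite /div !(mderivB, mderivN) deriv_integ.
  rewrite -div_cross /div !mderivB in E.
  by move/eqP: E; rewrite subr_eq => /eqP->; ring.
apply/bclassP; exists u', v', w'; rewrite /curl_along -ea -eb -ec.
by rewrite /along; ring.
Qed.

Lemma primitive_linear : linear primitive.
Proof.
move=> k g h; rewrite -[g]bclassK -[h]bclassK.
rewrite -(div_integ (repr g)) -(div_integ (repr h)) -linearP -divP.
by rewrite !primitive_div alongP linearP.
Qed.
HB.instance Definition _ :=
  GRing.isLinear.Build K brieskorn brieskorn *:%R primitive primitive_linear.

Lemma mulF_class p : mulF (bclass p) = bclass (F * p).
Proof.
have [u [v [w E]]] := bclass_repr p.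
apply/bclassP; exists (F * u), (F * v), (F * w).
rewrite -mulrBr E /curl_along /along !mderivM.
by ring.
Qed.

Lemma mulF_linear : linear mulF.
Proof.
move=> k g h; rewrite -[g]bclassK -[h]bclassK -linearP !mulF_class -linearP.
by congr (bclass _); rewrite mulrDr scalerAr.
Qed.
HB.instance Definition _ :=
  GRing.isLinear.Build K brieskorn brieskorn *:%R mulF mulF_linear.

(** Apply the primitive to div(F w) = F div w + grad F . w. *)
Lemma mulF_primitive h : mulF (primitive h) = primitive (mulF h) + primitive (primitive h).
Proof.
rewrite -[h]bclassK -(div_integ (repr h)); set a := integ _ _.
rewrite primitive_div !mulF_class -linearD -linearD /= -div_mulF primitive_div.
by congr (bclass _); rewrite /along; ring.
Qed.

Hypothesis koszul : forall a b c, along a b c = 0 -> exists u v w,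
  [/\ a = v * Fz - w * Fy, b = w * Fx - u * Fz & c = u * Fy - v * Fx].

Variables (n : nat) (e : 'I_n -> P) (d : 'I_n -> K).

Hypothesis e_gen : forall Q : P -> Prop,
  (forall i, Q (e i)) -> (forall (k : K) p q, Q p -> Q q -> Q (k *: p + q)) ->
  (forall a b c, Q (div a b c) -> Q (along a b c)) -> forall p, Q p.

Hypothesis e_free : forall (k : 'I_n -> K) a b c,
  \sum_i k i *: e i = along a b c -> forall i, k i = 0.

Hypothesis mulF_e : forall i, exists (k : 'I_n -> K) a b c,
  F * e i = \sum_j k j *: e j + along a b c /\ div a b c = d i *: e i.

Hypothesis d_neq0 : forall i k, d i + k.+1%:R != 0.

Let E i := bclass (e i).

Lemma comb_class k : comb E k = bclass (\sum_i k i *: e i).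
Proof. by rewrite linear_sum; apply: eq_bigr => i _; rewrite linearZ. Qed.

Lemma brieskorn_gen (Q : brieskorn -> Prop) :
  (forall i, Q (E i)) -> (forall (k : K) g h, Q g -> Q h -> Q (k *: g + h)) ->
  (forall h, Q h -> Q (primitive h)) -> forall h, Q h.
Proof.
move=> Qe QP Qprim h; rewrite -[h]bclassK; move: (repr h).
apply: e_gen => // [k p q Qp Qq|a b c Qd]; first by rewrite linearP; apply: QP.
by rewrite -primitive_div; apply: Qprim.
Qed.

(** Independence modulo the image of grad F gives the coefficients; then Koszul
    exactness shows that a field w with grad F . w = grad F . curl q is
    curl q + q' x grad F, so that its divergence is zero in the quotient. *)
Lemma brieskorn_free k h : comb E k + primitive h = 0 -> (forall i, k i = 0) /\ h = 0.
Proof.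
rewrite -[h]bclassK -(div_integ (repr h)) primitive_div comb_class -linearD.
set a := integ _ _; rewrite -(linear0 bclass) => /bclassP[u [v [w]]].
rewrite subr0 => E0.
have k0 : forall i, k i = 0.
  apply: (e_free (a := w^`M(i2) - v^`M(i3) - a) (b := u^`M(i3) - w^`M(i1))
    (c := v^`M(i1) - u^`M(i2))).
  by apply: (addIr (along a 0 0)); rewrite E0 /curl_along /along; ring.
split=> //; move: E0; rewrite big1 ?add0r; last by move=> i _; rewrite k0 scale0r.
move=> E0; apply/bclassP.
have [|u' [v' [w' [ea eb ec]]]] := @koszul (a - (w^`M(i2) - v^`M(i3)))
    (- (u^`M(i3) - w^`M(i1))) (- (v^`M(i1) - u^`M(i2))).
  by move/eqP: E0; rewrite -subr_eq0 => /eqP<-; rewrite /curl_along /along; ring.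
exists u', v', w'; rewrite -div_cross -ea -eb -ec subr0 /div.
rewrite !(mderivB, mderivN, mderiv0).
by rewrite (mderiv_comm i1 i2 w) (mderiv_comm i1 i3 v) (mderiv_comm i2 i3 u); ring.
Qed.

Lemma brieskorn_mulF : exists M : 'I_n -> 'I_n -> K, forall i,
  mulF (E i) = comb E (M i) + d i *: primitive (E i).
Proof.
have /choice[M MP] : forall i, exists k : 'I_n -> K,
    mulF (E i) = comb E k + d i *: primitive (E i).
  move=> i; have [k [a [b [c [Fe de]]]]] := mulF_e i.
  by exists k; rewrite /E mulF_class Fe linearD comb_class -linearZ -linearZ -de
    -primitive_div.
by exists M.
Qed.

(** The last two terms are the divergences of q x grad F and F w, the fields
    which define the zero two-form on the surface. *)
Theorem divergence_span p : exists (k : 'I_n -> K) u v w a b c,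
  p = \sum_i k i *: e i + curl_along u v w + div (F * a) (F * b) (F * c).
Proof.
have [M MP] := brieskorn_mulF.
have [k [h]] := comb_TP_span mulF_primitive brieskorn_gen MP d_neq0 (bclass p).
rewrite -[h]bclassK -(div_integ (repr h)); set a := integ _ _.
rewrite /= mulF_class primitive_div -linearD -div_mulF comb_class -linearD.
move=> /bclassP[u [v [w E0]]]; exists k, u, v, w, a, 0, 0.
by rewrite addrAC -E0 addrC subrK.
Qed.

Theorem divergence_free (k : 'I_n -> K) u v w a b c :
  \sum_i k i *: e i = curl_along u v w + div (F * a) (F * b) (F * c) ->
  forall i, k i = 0.
Proof.
move=> E0; have [M MP] := brieskorn_mulF.
apply: (comb_TP_complement mulF_primitive brieskorn_gen brieskorn_free MP d_neq0
  (h := bclass (div a b c))).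
rewrite /= comb_class mulF_class primitive_div -linearD -div_mulF; apply/bclassP.
by exists u, v, w; rewrite E0 addrK.
Qed.

End Brieskorn.

(** * The family of cubics *)

Section Cubic.
Variable K : numClosedFieldType.
Local Notation P := {mpoly K[3]}.
Variables k A B C : K.

Local Notation X := ('X_i1 : P).
Local Notation Y := ('X_i2 : P).
Local Notation Z := ('X_i3 : P).

(** The linear coefficients are written 2A, 2B, 2C because the partial derivatives
    and the basis below then have no denominators. *)
Definition cubic : P :=
  k%:MP + (2 * A) *: X + (2 * B) *: Y + (2 * C) *: Z
  - X ^+ 2 - Y ^+ 2 - Z ^+ 2 - X * Y * Z.

Local Notation a := (A%:MP : P).
Local Notation b := (B%:MP : P).
Local Notation c := (C%:MP : P).

Lemma cubicE : cubic = k%:MP + 2 * a * X + 2 * b * Y + 2 * c * Z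
  - X * X - Y * Y - Z * Z - X * Y * Z.
Proof. by rewrite /cubic -!mul_mpolyC !mpolyCM !mpolyC_nat !expr2. Qed.

Lemma mderiv_nat i m : (m%:R : P)^`M(i) = 0.
Proof. by rewrite -mpolyC_nat mderivC. Qed.

Lemma axesE : (((i1 == i1) = true) * ((i1 == i2) = false) * ((i1 == i3) = false) *
  ((i2 == i1) = false) * ((i2 == i2) = true) * ((i2 == i3) = false) *
  ((i3 == i1) = false) * ((i3 == i2) = false) * ((i3 == i3) = true))%type.
Proof. by []. Qed.

Definition mderivE := (mderivD, mderivB, mderivN, mderivM, mderivXU, mderivC,
  mderiv_nat, @mderiv0 3 K, (mpolyC0, mpolyC1)).

Lemma cubicx : cubic^`M(i1) = 2 * a - 2 * X - Y * Z.
Proof. by rewrite cubicE ?mderivE /= ?mderivE; ring. Qed.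
Lemma cubicy : cubic^`M(i2) = 2 * b - 2 * Y - X * Z.
Proof. by rewrite cubicE ?mderivE /= ?mderivE; ring. Qed.
Lemma cubicz : cubic^`M(i3) = 2 * c - 2 * Z - X * Y.
Proof. by rewrite cubicE ?mderivE /= ?mderivE; ring. Qed.

(** Modulo the partial derivatives the last element is -(xyz + 4) / 2, which is
    symmetric in the variables. With x^2 in its place, the action of F would not be
    diagonal in degree one of P. *)
Definition cubic_basis (i : 'I_5) : P := nth 0 [:: 1; X; Y; Z; X * X - a * X - 2] i.
Definition cubic_weight (i : 'I_5) : K := nth 0 [:: 1; 3 / 2; 3 / 2; 3 / 2; 2] i.

Lemma cubic_basis_sum (s : seq K) : \sum_(i < 5) s`_i *: cubic_basis i =
  (s`_0)%:MP + (s`_1)%:MP * X + (s`_2)%:MP * Y + (s`_3)%:MP * Z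
  + (s`_4)%:MP * (X * X - a * X - 2).
Proof.
rewrite !big_ord_recl big_ord0 /cubic_basis /= -!mul_mpolyC; ring.
Qed.

(** The field (0, y, z) of divergence 2 gives 2F = grad F . (0, y, z) + 2k + 4Ax
    + 2By + 2Cz - 2x^2; the other fields are this one times e_i, corrected so that
    the remaining monomials of degree at least two are rewritten by the partial
    derivatives. The witnesses list the coordinates of the remainder, then the
    field. *)
Lemma mul_cubic_basis2 i : exists (s : seq K) u v w,
  2 * (cubic * cubic_basis i) = \sum_(j < 5) s`_j *: cubic_basis j + along cubic u v w
  /\ div u v w = (2 * cubic_weight i) *: cubic_basis i.
Proof.
have mulr32 : 2 * (3 / 2) = 3 :> K by rewrite mulrC divfK // pnatr_eq0.
rewrite /along cubicx cubicy cubicz cubicE /div.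
case: i => [[|[|[|[|[|//]]]]] hi] /=.
- exists [:: 2 * k - 4; 2 * A; 2 * B; 2 * C; - 2], 0, Y, Z.
  rewrite cubic_basis_sum /= /cubic_basis /cubic_weight /=; split.
    by ring.
  by rewrite -!mul_mpolyC ?mderivE /= ?mderivE; ring.
- exists [:: 12 * A + 12 * B * C; 2 * (k - 4 + A * A); - 8 * C; - 8 * B; 2 * A],
    (X * X - 4), (- 2 * c), (X * Z + 2 * Y - 4 * b).
  rewrite cubic_basis_sum /= /cubic_basis /cubic_weight /=; split.
    by ring.
  by rewrite -!mul_mpolyC mulr32 ?mderivE /= ?mderivE; ring.
- exists [:: 12 * B + 12 * A * C; - 8 * C; 2 * (k - 4 + B * B); - 8 * A; 2 * B],
    (- 2 * c + b * X), (Y * Y - 4 - b * Y), (Y * Z + 2 * X - 4 * a).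
  rewrite cubic_basis_sum /= /cubic_basis /cubic_weight /=; split.
    by ring.
  by rewrite -!mul_mpolyC mulr32 ?mderivE /= ?mderivE; ring.
- exists [:: 12 * C + 12 * A * B; - 8 * B; - 8 * A; 2 * (k - 4 + C * C); 2 * C],
    (X * Z + 2 * Y - 4 * b + c * X), (- 2 * a), (Z * Z - 4 - c * Z).
  rewrite cubic_basis_sum /= /cubic_basis /cubic_weight /=; split.
    by ring.
  by rewrite -!mul_mpolyC mulr32 ?mderivE /= ?mderivE; ring.
- exists [:: - 16 * (A * A + B * B + C * C) - 16 * A * B * C - 8; 12 * A + 12 * B * C;
      12 * B + 12 * A * C; 12 * C + 12 * A * B; 2 * k - 4],
    (X * X * X - 4 * X - 2 * a * X * X + 8 * a),
    (8 * b - 2 * c * X + a * X * Y + 2 * a * c - 2 * Y),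
    (X * X * Z + 2 * X * Y - 4 * b * X + 8 * c - 4 * a * Y + 6 * a * b - a * X * Z - 2 * Z).
  rewrite cubic_basis_sum /= /cubic_basis /cubic_weight /=; split.
    by ring.
  by rewrite -!mul_mpolyC ?mderivE /= ?mderivE; ring.
Qed.


Lemma mul_cubic_basis i : exists (s : 'I_5 -> K) u v w,
  cubic * cubic_basis i = \sum_j s j *: cubic_basis j + along cubic u v w
  /\ div u v w = cubic_weight i *: cubic_basis i.
Proof.
have [s [u [v [w [E D]]]]] := mul_cubic_basis2 i.
have V2 : (2 : K) != 0 by rewrite pnatr_eq0.
exists (fun j => 2^-1 * s`_j), (2^-1 *: u), (2^-1 *: v), (2^-1 *: w); split.
  have -> : \sum_(j < 5) (2^-1 * s`_j) *: cubic_basis j =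
      2^-1 *: \sum_(j < 5) s`_j *: cubic_basis j.
    by rewrite scaler_sumr; apply: eq_bigr => j _; rewrite scalerA.
  have -> : along cubic (2^-1 *: u) (2^-1 *: v) (2^-1 *: w) = 2^-1 *: along cubic u v w.
    by have := alongP cubic 2^-1 u v w 0 0 0; rewrite /along !mulr0 !addr0.
  by rewrite -scalerDr -E mulr_natl -scaler_nat scalerA mulVf ?scale1r.
have -> : div (2^-1 *: u) (2^-1 *: v) (2^-1 *: w) = 2^-1 *: div u v w.
  by have := divP 2^-1 u v w 0 0 0; rewrite /div !mderiv0 !addr0.
by rewrite D scalerA mulKf.
Qed.

Lemma cubic_weight_neq0 i j : cubic_weight i + j.+1%:R != 0.
Proof.
apply: lt0r_neq0; apply: addr_gt0; last by rewrite ltr0n.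
by rewrite /cubic_weight; case: i => [[|[|[|[|[|//]]]]] hi] /=; rewrite 
  ?divr_gt0 ?ltr0n ?ltr01.
Qed.

Section Generation.
Variable Q : P -> Prop.
Hypothesis Qbasis : forall i, Q (cubic_basis i).
Hypothesis QP : forall (r : K) p q, Q p -> Q q -> Q (r *: p + q).
Hypothesis Qdiv : forall u v w, Q (div u v w) -> Q (along cubic u v w).

Lemma gen0 : Q 0.
Proof. by have := QP (-1) (Qbasis 0) (Qbasis 0); rewrite scaleN1r addNr. Qed.

Lemma gen_scale r p : Q p -> Q (r%:MP * p).
Proof. by move=> Qp; have := QP r Qp gen0; rewrite addr0 mul_mpolyC. Qed.

Lemma gen_add p q : Q p -> Q q -> Q (p + q).
Proof. by move=> Qp Qq; have := QP 1 Qp Qq; rewrite scale1r. Qed.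

Lemma gen_opp p : Q p -> Q (- p).
Proof. by move=> Qp; have := QP (-1) Qp gen0; rewrite scaleN1r addr0. Qed.

Lemma gen_sub p q : Q p -> Q q -> Q (p - q).
Proof. by move=> Qp Qq; apply: gen_add => //; apply: gen_opp. Qed.

Lemma gen_natmul n p : Q p -> Q (n%:R * p).
Proof. by move=> Qp; rewrite -mpolyC_nat; apply: gen_scale. Qed.

Lemma gen_half p : Q (2 * p) -> Q p.
Proof.
move=> Qp; suff -> : p = (2^-1)%:MP * (2 * p) by apply: gen_scale.
by rewrite mulrCA mulrA (mulC_natV K 1) mul1r.
Qed.

Lemma gen1 : Q 1. Proof. exact: (Qbasis 0). Qed.
Lemma gen_X : Q X. Proof. exact: (Qbasis 1). Qed.
Lemma gen_Y : Q Y. Proof. exact: (Qbasis 2). Qed.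
Lemma gen_Z : Q Z. Proof. exact: (Qbasis 3). Qed.
Lemma gen_X2 : Q (X * X).
Proof.
suff -> : X * X = cubic_basis 4 + a * X + 2 * 1.
  apply: gen_add; last exact/gen_natmul/gen1.
  by apply: gen_add => //; apply/gen_scale/gen_X.
by rewrite /cubic_basis /=; ring.
Qed.

Local Notation mono i j l := (X ^+ i * Y ^+ j * Z ^+ l)%R.

(** The hypothesis of an induction on the degree. *)
Definition gen_below n := forall i j l, (i + j + l < n)%N -> Q (mono i j l).

(** F_x = 2A - 2x - yz rewrites a multiple of yz in lower degree, up to the
    primitive of a polynomial of lower degree. *)
Lemma gen_yz n i j l : gen_below n -> (i + j.+1 + l.+1 <= n)%N -> Q (mono i j.+1 l.+1).
Proof.
move=> IH le_n.
have -> : mono i j.+1 l.+1 = 2%:R * (a * mono i j l) - 2%:R * mono i.+1 j l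
    - along cubic (mono i j l) 0 0.
  by rewrite /along cubicx !exprS; ring.
apply: gen_sub; first apply: gen_sub.
- by apply/gen_natmul/gen_scale/IH; lia.
- by apply/gen_natmul/IH; lia.
apply: Qdiv; rewrite /div !mderiv0 !addr0.
rewrite !mderivM !mderivXn /= !mul0r !mulr0 !addr0 mul1n -!mulrA.
case: i le_n => [|i] le_n; first by rewrite mul0r; apply: gen0.
by apply: gen_natmul; rewrite mulrA; apply: IH; lia.
Qed.

Lemma gen_xz n i j l : gen_below n -> (i.+1 + j + l.+1 <= n)%N -> Q (mono i.+1 j l.+1).
Proof.
move=> IH le_n.
have -> : mono i.+1 j l.+1 = 2%:R * (b * mono i j l) - 2%:R * mono i j.+1 l
    - along cubic 0 (mono i j l) 0.
  by rewrite /along cubicy !exprS; ring.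
apply: gen_sub; first apply: gen_sub.
- by apply/gen_natmul/gen_scale/IH; lia.
- by apply/gen_natmul/IH; lia.
apply: Qdiv; rewrite /div !mderiv0 addr0 add0r.
rewrite !mderivM !mderivXn /= !mul0r !mulr0 !addr0 add0r mul1n -!mulrA.
case: j le_n => [|j] le_n; first by rewrite mul0r mulr0; apply: gen0.
by rewrite mulrCA; apply: gen_natmul; rewrite mulrA; apply: IH; lia.
Qed.

Lemma gen_xy n i j l : gen_below n -> (i.+1 + j.+1 + l <= n)%N -> Q (mono i.+1 j.+1 l).
Proof.
move=> IH le_n.
have -> : mono i.+1 j.+1 l = 2%:R * (c * mono i j l) - 2%:R * mono i j l.+1
    - along cubic 0 0 (mono i j l).
  by rewrite /along cubicz !exprS; ring.
apply: gen_sub; first apply: gen_sub.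
- by apply/gen_natmul/gen_scale/IH; lia.
- by apply/gen_natmul/IH; lia.
apply: Qdiv; rewrite /div !mderiv0 !add0r.
rewrite !mderivM !mderivXn /= !mul0r !mulr0 !addr0 mul0r add0r mul1n.
case: l le_n => [|l] le_n; first by rewrite mul0r mulr0; apply: gen0.
by rewrite mulrCA; apply: gen_natmul; apply: IH; lia.
Qed.

(** The field (x, -y, 0) is divergence free and trades x^2 for y^2; after
    multiplication by a power of x the result is divisible by xy, except for lower
    terms. *)
Lemma gen_xpow n m : gen_below n -> (m <= n)%N -> Q (X ^+ m).
Proof.
move=> IH; case: m => [|[|[|m]]] le_n; rewrite ?expr0 ?expr1 ?expr2.
- exact: gen1.
- exact: gen_X.
- exact: gen_X2.
apply: gen_half.
have -> : 2 * X ^+ m.+3 = 2%:R * mono m.+1 2 0 + 2%:R * (a * mono m.+2 0 0)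
    - 2%:R * (b * mono m.+1 1 0) - along cubic (X ^+ m.+2) (- (X ^+ m.+1 * Y)) 0.
  by rewrite /along cubicx cubicy !exprS !expr0; ring.
apply: gen_sub; first apply: gen_sub; first apply: gen_add.
- by apply/gen_natmul/(gen_xy IH); lia.
- by apply/gen_natmul/gen_scale/IH; lia.
- by apply/gen_natmul/gen_scale/IH; lia.
apply: Qdiv; rewrite /div !(mderivXn, mderivE, axesE, mul1n, mul0n, succnK).
have -> : m.+2%:R * X ^+ m.+1 + - (0%:R * X ^+ m * Y + X ^+ m.+1 * 1) + 0 =
    m.+1%:R * mono m.+1 0 0 by rewrite expr0; ring.
by apply/gen_natmul/IH; lia.
Qed.

Lemma gen_ypow n m : gen_below n -> (m <= n)%N -> Q (Y ^+ m).
Proof.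
move=> IH; case: m => [|[|m]] le_n; rewrite ?expr0 ?expr1.
- exact: gen1.
- exact: gen_Y.
apply: gen_half.
have -> : 2 * Y ^+ m.+2 = 2%:R * mono 2 m 0 - 2%:R * (a * mono 1 m 0)
    + 2%:R * (b * mono 0 m.+1 0) + along cubic (X * Y ^+ m) (- Y ^+ m.+1) 0.
  by rewrite /along cubicx cubicy !exprS !expr0; ring.
apply: gen_add; first apply: gen_add; first apply: gen_sub.
- apply: gen_natmul; case: m le_n => [|m] le_n; last by apply: (gen_xy IH); lia.
  by rewrite !expr0 !mulr1 expr2; apply: gen_X2.
- by apply/gen_natmul/gen_scale/IH; lia.
- by apply/gen_natmul/gen_scale/IH; lia.
apply: Qdiv; rewrite /div !(mderivXn, mderivE, axesE, mul1n, mul0n, succnK).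
have -> : 1 * Y ^+ m + X * (0%:R * Y ^+ m.-1) + - (m.+1%:R * Y ^+ m) + 0 =
    - (m%:R * mono 0 m 0) by rewrite expr0; ring.
by apply/gen_opp/gen_natmul/IH; lia.
Qed.

Lemma gen_zpow n m : gen_below n -> (m <= n)%N -> Q (Z ^+ m).
Proof.
move=> IH; case: m => [|[|m]] le_n; rewrite ?expr0 ?expr1.
- exact: gen1.
- exact: gen_Z.
apply: gen_half.
have -> : 2 * Z ^+ m.+2 = 2%:R * mono 2 0 m - 2%:R * (a * mono 1 0 m)
    + 2%:R * (c * mono 0 0 m.+1) + along cubic (X * Z ^+ m) 0 (- Z ^+ m.+1).
  by rewrite /along cubicx cubicz !exprS !expr0; ring.
apply: gen_add; first apply: gen_add; first apply: gen_sub.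
- apply: gen_natmul; case: m le_n => [|m] le_n; last by apply: (gen_xz IH); lia.
  by rewrite !expr0 !mulr1 expr2; apply: gen_X2.
- by apply/gen_natmul/gen_scale/IH; lia.
- by apply/gen_natmul/gen_scale/IH; lia.
apply: Qdiv; rewrite /div !(mderivXn, mderivE, axesE, mul1n, mul0n, succnK).
have -> : 1 * Z ^+ m + X * (0%:R * Z ^+ m.-1) + 0 + - (m.+1%:R * Z ^+ m) =
    - (m%:R * mono 0 0 m) by rewrite expr0; ring.
by apply/gen_opp/gen_natmul/IH; lia.
Qed.

Lemma gen_all n : gen_below n.
Proof.
elim: n => [|n IH] i j l; first by rewrite ltn0.
rewrite ltnS; case: l => [|l] le_n.
  case: j le_n => [|j] le_n; first by rewrite !expr0 !mulr1; apply: (gen_xpow IH); lia.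
  case: i le_n => [|i] le_n; first by rewrite !expr0 mul1r mulr1; apply: (gen_ypow IH); lia.
  exact: (gen_xy IH).
case: j le_n => [|j] le_n; last exact: (gen_yz IH).
case: i le_n => [|i] le_n; first by rewrite !expr0 !mul1r; apply: (gen_zpow IH); lia.
exact: (gen_xz IH).
Qed.

End Generation.

Lemma monomE m : 'X_[m] = X ^+ m i1 * Y ^+ m i2 * Z ^+ m i3.
Proof.
rewrite mpolyXE_id !big_ord_recl big_ord0 mulr1 mulrA.
by congr (_ ^+ (m _) * _ ^+ (m _) * _ ^+ (m _)); rewrite ?(_ : _ = i2) ?(_ : _ = i3) //;
  apply/val_inj.
Qed.

Lemma cubic_basis_gen (Q : P -> Prop) :
  (forall i, Q (cubic_basis i)) -> (forall (r : K) p q, Q p -> Q q -> Q (r *: p + q)) ->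
  (forall u v w, Q (div u v w) -> Q (along cubic u v w)) -> forall p, Q p.
Proof.
move=> Qb QP Qd; apply: mpoly_monom_ind => // m.
by rewrite monomE; apply: (gen_all Qb QP Qd (leqnn _)).
Qed.


End Cubic.

(** * The Jacobian ring *)

Section JacobianRing.
Variable K : numClosedFieldType.
Local Notation P := {mpoly K[3]}.
Variables k A B C : K.

Local Notation X := ('X_i1 : P).
Local Notation Y := ('X_i2 : P).
Local Notation Z := ('X_i3 : P).
Local Notation a := (A%:MP : P).
Local Notation b := (B%:MP : P).
Local Notation c := (C%:MP : P).

Definition rows5 (s : seq (seq K)) : 'M[K]_5 := \matrix_(i, j) nth 0 (nth [::] s i) j.

(** Row i of each matrix lists the coordinates, in [cubic_basis], of the product of
    the variable with the i-th element modulo the partial derivatives. *)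
Definition jacX := rows5
  [:: [:: 0; 1; 0; 0; 0]; [:: 2; A; 0; 0; 1]; [:: 2 * C; 0; 0; -2; 0];
      [:: 2 * B; 0; -2; 0; 0]; [:: - 4 * A - 2 * B * C; 2; 2 * C; 2 * B; 0]].
Definition jacY := rows5
  [:: [:: 0; 0; 1; 0; 0]; [:: 2 * C; 0; 0; -2; 0]; [:: 2; 0; B; 0; 1];
      [:: 2 * A; -2; 0; 0; 0]; [:: - 4 * B - 2 * A * C; 2 * C; 2; 2 * A; 0]].
Definition jacZ := rows5
  [:: [:: 0; 0; 0; 1; 0]; [:: 2 * B; 0; -2; 0; 0]; [:: 2 * A; -2; 0; 0; 0];
      [:: 2; 0; 0; C; 1]; [:: - 4 * C - 2 * A * B; 2 * B; 2 * A; 2; 0]].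

Local Ltac jac_entries :=
  let i := fresh "i" in let j := fresh "j" in
  apply/matrixP=> i j; rewrite !mxE ?big_ord_recl ?big_ord0 ?mxE;
  case: i => [[|[|[|[|[|//]]]]] ?]; case: j => [[|[|[|[|[|//]]]]] ?];
  rewrite /= ?mulr1n ?mulr0n; ring.

Lemma jacXY : jacX *m jacY = jacY *m jacX. Proof. jac_entries. Qed.
Lemma jacXZ : jacX *m jacZ = jacZ *m jacX. Proof. jac_entries. Qed.
Lemma jacYZ : jacY *m jacZ = jacZ *m jacY. Proof. jac_entries. Qed.

Lemma jac_relx : jacY *m jacZ = (2 * A)%:M - 2 *: jacX. Proof. jac_entries. Qed.
Lemma jac_rely : jacX *m jacZ = (2 * B)%:M - 2 *: jacY. Proof. jac_entries. Qed.
Lemma jac_relz : jacX *m jacY = (2 * C)%:M - 2 *: jacZ. Proof. jac_entries. Qed.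

(** The evaluation of a polynomial at the commuting matrices. *)
Definition jac : P -> 'M[K]_5 :=
  mlift (fun m => jacX ^+ m i1 * jacY ^+ m i2 * jacZ ^+ m i3).
HB.instance Definition _ :=
  GRing.isLinear.Build K P 'M[K]_5 *:%R jac (mlift_linear _).

Lemma jacE i j l : jac (X ^+ i * Y ^+ j * Z ^+ l) = jacX ^+ i * jacY ^+ j * jacZ ^+ l.
Proof.
rewrite !mpolyXn -!mpolyXD /jac mliftX; congr (_ ^+ _ * _ ^+ _ * _ ^+ _);
by rewrite !mnmDE !mulmnE !mnm1E !axesE ?mul0n ?mul1n ?addn0.
Qed.

Lemma jac_mul (N : 'M[K]_5) i : (forall m, jac ('X_i * 'X_[m]) = N * jac 'X_[m]) ->
  forall p : P, jac ('X_i * p) = N * jac p.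
Proof.
move=> H; elim/mpoly_monom_ind => // r p q IHp IHq.
by rewrite mulrDr -scalerAr !linearP /= IHp IHq mulrDr scalerAr.
Qed.

Lemma jac_mulX p : jac (X * p) = jacX * jac p.
Proof.
by move: p; apply: jac_mul => m; rewrite ['X_[m]]monomE !mulrA -exprS !jacE exprS !mulrA.
Qed.

Lemma jac_mulY p : jac (Y * p) = jacY * jac p.
Proof.
move: p; apply: jac_mul => m.
rewrite ['X_[m]]monomE (_ : _ * _ = X ^+ m i1 * Y ^+ (m i2).+1 * Z ^+ m i3); last first.
  by rewrite exprS; ring.
rewrite !jacE exprS !mulrA; congr (_ * _ * _).
have cX : GRing.comm jacY (jacX ^+ m i1) by apply: commrX; apply/esym/jacXY.
by rewrite cX.
Qed.

Lemma jac_mulZ p : jac (Z * p) = jacZ * jac p.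
Proof.
move: p; apply: jac_mul => m.
rewrite ['X_[m]]monomE (_ : _ * _ = X ^+ m i1 * Y ^+ m i2 * Z ^+ (m i3).+1); last first.
  by rewrite exprS; ring.
rewrite !jacE exprS !mulrA; congr (_ * _).
have cX : GRing.comm jacZ (jacX ^+ m i1) by apply: commrX; apply/esym/jacXZ.
have cY : GRing.comm jacZ (jacY ^+ m i2) by apply: commrX; apply/esym/jacYZ.
by rewrite -mulrA -cY mulrA -cX.
Qed.

Lemma jac_grad (D : K) (i1' i2' i3' : 'I_3) (N1 N2 N3 : 'M[K]_5) :
  (forall p, jac ('X_i1' * p) = N1 * jac p) -> (forall p, jac ('X_i2' * p) = N2 * jac p) ->
  (forall p, jac ('X_i3' * p) = N3 * jac p) -> N2 *m N3 = (2 * D)%:M - 2 *: N1 ->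
  forall p, jac ((2 * D%:MP - 2 * 'X_i1' - 'X_i2' * 'X_i3') * p) = 0.
Proof.
move=> j1 j2 j3 N23 p.
have -> : (2 * D%:MP - 2 * 'X_i1' - 'X_i2' * 'X_i3') * p =
    (2 * D) *: p - 2 *: ('X_i1' * p) - 'X_i2' * ('X_i3' * p).
  by rewrite -!mul_mpolyC mpolyCM mpolyC_nat; ring.
rewrite !linearB !linearZ /= j1 j2 j3 mulrA.
have -> : N2 * N3 = (2 * D) *: 1 - 2 *: N1 by rewrite -[N2 * N3]/(N2 *m N3) N23 -scalemx1.
by rewrite mulrBl -!scalerAl mul1r scalerN subrr.
Qed.

Lemma jac_along u v w : jac (along (cubic k A B C) u v w) = 0.
Proof.
rewrite /along cubicx cubicy cubicz !linearD /=.
rewrite (jac_grad jac_mulX jac_mulY jac_mulZ jac_relx).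
rewrite (jac_grad jac_mulY jac_mulX jac_mulZ jac_rely).
by rewrite (jac_grad jac_mulZ jac_mulX jac_mulY jac_relz) !addr0.
Qed.

Lemma jac_basis i j : jac (cubic_basis A i) 0 j = (i == j)%:R.
Proof.
have j1 : jac 1 = 1 by rewrite /jac -mpolyX0 mliftX !mnm0E !expr0 !mulr1.
have jX p : jac ('X_p) = jac ('X_p * 1) by rewrite mulr1.
have jXX : jac (X * X) = jacX * jacX by rewrite jac_mulX jX jac_mulX j1 mulr1.
rewrite /cubic_basis; case: i => [[|[|[|[|[|//]]]]] hi] /=.
- by rewrite j1 mxE; case: j => [[|[|[|[|[|//]]]]] ?].
- by rewrite jX jac_mulX j1 mulr1 mxE; case: j => [[|[|[|[|[|//]]]]] ?].
- by rewrite jX jac_mulY j1 mulr1 mxE; case: j => [[|[|[|[|[|//]]]]] ?].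
- by rewrite jX jac_mulZ j1 mulr1 mxE; case: j => [[|[|[|[|[|//]]]]] ?].
have -> : X * X - a * X - 2 = X * X - A *: X - 2 *: 1.
  by rewrite -!mul_mpolyC mpolyC_nat mulr1.
rewrite !linearB !linearZ /= j1 jXX jX jac_mulX j1 mulr1.
rewrite !mxE !big_ord_recl big_ord0 !mxE.
by case: j => [[|[|[|[|[|//]]]]] ?]; rewrite /= ?mulr1n ?mulr0n; ring.
Qed.

(** The matrices satisfy the partial derivatives, and the first row of the value
    of the i-th basis element is the i-th unit vector. *)
Lemma cubic_basis_free (s : 'I_5 -> K) u v w :
  \sum_i s i *: cubic_basis A i = along (cubic k A B C) u v w -> forall i, s i = 0.
Proof.
move=> /(congr1 jac); rewrite jac_along linear_sum => /matrixP E j.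
have := E 0 j; rewrite summxE mxE (bigD1 j) //= linearZ mxE jac_basis eqxx mulr1.
rewrite big1 ?addr0 // => i /negPf ij.
by rewrite linearZ mxE jac_basis ij mulr0.
Qed.


End JacobianRing.

(** * Exactness of the Koszul complex *)

Section Koszul.
Variable K : numClosedFieldType.
Local Notation P := {mpoly K[3]}.
Variables k A B C : K.

Local Notation X := ('X_i1 : P).
Local Notation Y := ('X_i2 : P).
Local Notation Z := ('X_i3 : P).
Local Notation a := (A%:MP : P).
Local Notation b := (B%:MP : P).
Local Notation c := (C%:MP : P).

Definition subst i (q : P) : P -> P :=
  comp_mpoly [tuple if j == i then q else 'X_j | j < 3].
HB.instance Definition _ i q := GRing.RMorphism.on (subst i q).

Lemma substXU i q j : subst i q 'X_j = if j == i then q else 'X_j.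
Proof. by rewrite /subst comp_mpolyXU -tnth_nth tnth_mktuple. Qed.

Lemma substC i q (r : K) : subst i q r%:MP = r%:MP.
Proof. exact: comp_mpolyC. Qed.

Lemma subst_diff i q p : exists w, p - subst i q p = ('X_i - q) * w.
Proof.
elim/mpoly_alg_ind: p => [r|j|p p' [w Ew] [w' Ew']|p p' [w Ew] [w' Ew']].
- by exists 0; rewrite substC subrr mulr0.
- rewrite substXU; case: eqVneq => [->|_]; first by exists 1; rewrite mulr1.
  by exists 0; rewrite subrr mulr0.
- by exists (w + w'); rewrite rmorphD mulrDr -Ew -Ew' /=; ring.
- exists (w * p' + subst i q p * w').
  by rewrite rmorphM mulrDr mulrA -Ew mulrCA -Ew' /=; ring.
Qed.

Lemma XsubC_neq0 i (r : K) : 'X_i - r%:MP != 0 :> P.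
Proof.
apply/eqP=> /(congr1 (mcoeff U_(i))).
rewrite mcoeffB mcoeffXU eqxx mcoeffC mnm1_eq0 mulr0 subr0 mcoeff0 => /eqP.
by rewrite oner_eq0.
Qed.

(** The polynomials x_i - r are prime, and none divides a nonzero polynomial which
    does not involve the i-th variable. *)
Lemma linear_factors_dvd i (s : P) rs u v :
  s != 0 -> (forall r : K, subst i r%:MP s = s) ->
  (\prod_(r <- rs) ('X_i - r%:MP)) * u = s * v ->
  exists w, v = (\prod_(r <- rs) ('X_i - r%:MP)) * w.
Proof.
move=> s0 sub_s; elim: rs v => [|r rs IH] v; first by exists v; rewrite big_nil mul1r.
rewrite big_cons => E.
have v0 : subst i r%:MP v = 0.
  have := congr1 (subst i r%:MP) E; rewrite !rmorphM rmorphB /= substXU eqxx substC.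
  by rewrite subrr !mul0r sub_s => /esym/eqP; rewrite mulf_eq0 (negPf s0) => /eqP.
have [v' Ev] := subst_diff i r%:MP v; rewrite v0 subr0 in Ev.
have [|w Ew] := IH v'; last by exists w; rewrite Ev Ew mulrA.
by apply: (mulfI (XsubC_neq0 i r)); rewrite mulrA E Ev mulrCA.
Qed.

(** Univariate polynomials in the i-th variable; they split over K. *)
Definition emb i : {poly K} -> P := horner_alg ('X_i : P).
HB.instance Definition _ i := GRing.LRMorphism.on (emb i).

Lemma emb_factor i r : exists rs,
  emb i r = (lead_coef r)%:MP * \prod_(z <- rs) ('X_i - z%:MP).
Proof.
have [rs {1}->] := closed_field_poly_normal r; exists rs.
rewrite /emb linearZ /= mulr_algl mul_mpolyC rmorph_prod.
congr (_ *: _).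
apply: eq_bigr => z _; rewrite rmorphB /= horner_algX horner_algC.
by rewrite -mul_mpolyC mulr1.
Qed.

Lemma subst_emb i j r q : i != j -> subst j q (emb i r) = emb i r.
Proof.
move=> ij; have [rs ->] := emb_factor i r.
rewrite rmorphM /= substC rmorph_prod; congr (_ * _); apply: eq_bigr => z _.
by rewrite rmorphB /= substXU substC (negPf ij).
Qed.

Lemma emb_neq0 i r : r != 0 -> emb i r != 0.
Proof.
move=> r0; have [rs ->] := emb_factor i r; rewrite mulf_neq0 //.
  by rewrite mpolyC_eq0 lead_coef_eq0.
elim: rs => [|z rs IH]; rewrite ?big_nil ?oner_eq0 // big_cons mulf_neq0 //.
exact: XsubC_neq0.
Qed.

Lemma emb_dvd i j r s u v : i != j -> r != 0 -> s != 0 ->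
  emb i r * u = emb j s * v -> exists w, v = emb i r * w.
Proof.
move=> ij r0 s0; have [rs ->] := emb_factor i r; rewrite -mulrA mulrCA => E.
have lr0 : lead_coef r != 0 by rewrite lead_coef_eq0.
have [||w ->] := linear_factors_dvd _ _ E; first exact: emb_neq0.
  by move=> z; rewrite subst_emb // eq_sym.
exists ((lead_coef r)^-1%:MP * w); rewrite mulrACA -mpolyCM mulfV // mpolyC1 mul1r.
by [].
Qed.

(** The combinations 2 F_x - y F_z and 2 F_y - x F_z do not involve z. Each is
    linear in one of the two remaining variables, and the elimination of this
    variable leaves a quintic in the other one. *)
Definition elim_f (D E : P) x y : P := 4 * D - 4 * x - 2 * E * y + x * y * y.

Definition quintic (D1 D2 D3 : K) : {poly K} :=
  foldl (fun p r => p * 'X + r%:P) (-4)%:P [:: 4 * D2; 32; - 8 * D1 * D3 - 32 * D2;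
    16 * D1 * D1 + 16 * D3 * D3 - 64; 64 * D2 - 32 * D1 * D3].

Lemma quintic_neq0 D1 D2 D3 : quintic D1 D2 D3 != 0.
Proof.
have c0 : (-4)%:P != 0 :> {poly K} by rewrite polyC_eq0 oppr_eq0 pnatr_eq0.
rewrite /quintic; move: c0; elim: [:: _; _; _; _; _] (-4)%:P => //= r rs IH p p0.
by apply: IH; rewrite -size_poly_eq0 size_MXaddC (negPf p0).
Qed.

Lemma embC i r : emb i r%:P = r%:MP.
Proof. by rewrite /emb horner_algC -mul_mpolyC mulr1. Qed.

Lemma emb_MXaddC i p r : emb i (p * 'X + r%:P) = emb i p * 'X_i + r%:MP.
Proof.
by rewrite /emb rmorphD rmorphM /= horner_algX horner_algC -mul_mpolyC mulr1.
Qed.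

Lemma emb_quintic i j D1 D2 D3 : exists u v,
  emb j (quintic D1 D2 D3) = u * elim_f D1%:MP D3%:MP 'X_i 'X_j
     + v * elim_f D2%:MP D3%:MP 'X_j 'X_i.
Proof.
pose x : P := 'X_i; pose y : P := 'X_j; pose p := y * y - 4.
pose q := 4 * D1%:MP - 2 * D3%:MP * y; pose f := elim_f D1%:MP D3%:MP x y.
exists (- (y * (f - 2 * q) - 2 * D3%:MP * p)), (p * p).
rewrite /quintic /= !emb_MXaddC embC -/x -/y /f /p /q /elim_f.
by ring.
Qed.

(** The ideal (f, g) contains a quintic r(y) and a quintic s(x). From
    f u + g v = 0, both r u and s u are multiples of g, and r, s have no common
    factor, so u is one. *)
Lemma elim_coprime u v : let f := elim_f a c X Y in let g := elim_f b c Y X in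
  f * u + g * v = 0 -> exists w, u = g * w /\ v = - f * w.
Proof.
move=> f g E.
have [r1 [r2]] := emb_quintic i1 i2 A B C.
have [s1 [s2]] := emb_quintic i2 i1 B A C.
rewrite -/f -/g; set s := emb i1 _; set r := emb i2 _ => Es Er.
have Efu : f * u = - (g * v) by apply/eqP; rewrite -addr_eq0 E.
have ru : s * u = g * (s1 * u - s2 * v).
  by rewrite Es mulrDl -[s2 * f * u]mulrA Efu; ring.
have su : r * u = g * (r2 * u - r1 * v).
  by rewrite Er mulrDl -[r1 * f * u]mulrA Efu; ring.
have g0 : g != 0.
  apply/eqP=> /(congr1 (fun p : P => p^`M(i1)^`M(i1)^`M(i2))).
  have -> : g = (4 * b - 4 * Y - 2 * c * X) + Y * X * X by rewrite /g /elim_f; ring.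
  rewrite !(mderivE, axesE) => /eqP; rewrite (_ : _ + _ = 2); last by ring.
  by rewrite -mpolyC_nat mpolyC_eq0 pnatr_eq0.
have [r0 s0] := (quintic_neq0 A B C, quintic_neq0 B A C).
have [|w Ew] := @emb_dvd i2 i1 _ _ (s1 * u - s2 * v) (r2 * u - r1 * v) isT r0 s0.
  by apply: (mulfI g0); rewrite mulrCA -ru [RHS]mulrCA -su mulrCA.
have Eu : u = g * w.
  have rn0 : r != 0 by apply: emb_neq0.
  by apply: (mulfI rn0); rewrite su Ew mulrCA.
exists w; split=> //; apply: (mulfI g0).
by move/eqP: E; rewrite addrC addr_eq0 => /eqP->; rewrite Eu; ring.
Qed.

(** F_z is linear in z, so modulo F_z every polynomial is one in x and y. There
    f and g form a regular sequence, which gives the relation up to multiples of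
    F_z; these are absorbed by q1 and q2. *)
Lemma cubic_koszul u v w : let F := cubic k A B C in along F u v w = 0 ->
  exists q1 q2 q3, [/\ u = q2 * F^`M(i3) - q3 * F^`M(i2),
    v = q3 * F^`M(i1) - q1 * F^`M(i3) & w = q1 * F^`M(i2) - q2 * F^`M(i1)].
Proof.
rewrite /along /= => E; set Fx := _^`M(i1) in E *; set Fy := _^`M(i2) in E *.
set Fz := _^`M(i3) in E *.
pose f := elim_f a c X Y; pose g := elim_f b c Y X.
have Ef : f = 2 * Fx - Y * Fz by rewrite /f /elim_f /Fx /Fz cubicx cubicz; ring.
have Eg : g = 2 * Fy - X * Fz by rewrite /g /elim_f /Fy /Fz cubicy cubicz; ring.
(* The root of F_z in z. *)
pose z := (2^-1)%:MP * (2 * c - X * Y); pose sub : {rmorphism P -> P} := subst i3 z.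
have half2 : 2 * (2^-1)%:MP = 1 :> P := mulC_natV K 1.
have EFz : Fz = - 2 * (Z - z).
  transitivity (- 2 * Z + (2 * (2^-1)%:MP) * (2 * c - X * Y)); last by rewrite /z; ring.
  by rewrite half2 /Fz cubicz; ring.
have Fz0 : Fz != 0.
  apply/eqP=> /(congr1 (fun p : P => p^`M(i3))).
  rewrite /Fz cubicz !(mderivE, axesE) => /eqP.
  rewrite (_ : _ - _ = - 2); last by ring.
  by rewrite oppr_eq0 -mpolyC_nat mpolyC_eq0 pnatr_eq0.
have subz : sub z = z.
  by rewrite /z !(rmorph_nat, rmorphB, rmorphM) /= !substXU !substC ?axesE.
have subFz : sub Fz = 0.
  by rewrite EFz rmorphM rmorphB subz /= substXU eqxx subrr mulr0.
have subf : sub f = f.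
  by rewrite /f /elim_f !(rmorph_nat, rmorphB, rmorphD, rmorphM) /= !substXU !substC ?axesE.
have subg : sub g = g.
  by rewrite /g /elim_f !(rmorph_nat, rmorphB, rmorphD, rmorphM) /= !substXU !substC ?axesE.
have [t [Eu Ev]] : exists w, sub u = g * w /\ sub v = - f * w.
  apply: elim_coprime; rewrite -/f -/g -subf -subg -!rmorphM -rmorphD.
  have -> : f * u + g * v = - (2 * w + u * Y + v * X) * Fz.
    transitivity (2 * (Fx * u + Fy * v + Fz * w) - (2 * w + u * Y + v * X) * Fz).
      by rewrite Ef Eg; ring.
    by rewrite E mulr0 sub0r mulNr.
  by rewrite rmorphM /= subFz mulr0.
have mod_z p : exists p', p = sub p + Fz * p'.
  have [p' Ep] := subst_diff i3 z p; exists (- (2^-1)%:MP * p').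
  rewrite EFz [X in _ + X](_ : _ = 2 * (2^-1)%:MP * ((Z - z) * p')); last by ring.
  by rewrite half2 mul1r -Ep addrC subrK.
have [u1 Eu1] := mod_z u; have [v1 Ev1] := mod_z v.
have Eu2 : u = (u1 - X * t) * Fz - (- 2 * t) * Fy by rewrite Eu1 Eu Eg; ring.
have Ev2 : v = (- 2 * t) * Fx - (- (Y * t + v1)) * Fz by rewrite Ev1 Ev Ef; ring.
exists (- (Y * t + v1)), (u1 - X * t), (- 2 * t); split => //.
apply: (mulfI Fz0); move/eqP: E; rewrite addrC addr_eq0 => /eqP->.
by rewrite Eu2 Ev2; ring.
Qed.

End Koszul.

(** * Smoothness *)

Section Ideals.
Variables (K : numClosedFieldType).
Local Notation P := {mpoly K[3]}.

Definition ideal (I : P -> Prop) :=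
  (forall p q, I p -> I q -> I (p + q)) /\ (forall p q, I q -> I (p * q)).

Definition adjoin (I : P -> Prop) (g p : P) := exists h, I (p - h * g).

Lemma adjoin_ideal I g : ideal I -> ideal (adjoin I g).
Proof.
move=> [ID IM]; split=> [p q [h hp] [h' hq]|p q [h hq]].
  by exists (h + h'); rewrite mulrDl opprD addrACA; apply: ID.
by exists (p * h); rewrite -mulrA -mulrBr; apply: IM.
Qed.

Lemma sub_adjoin I g p : I p -> adjoin I g p.
Proof. by exists 0; rewrite mul0r subr0. Qed.

Lemma mem_adjoin I g : ideal I -> I 0 -> adjoin I g g.
Proof. by exists 1; rewrite mul1r subrr. Qed.

(** An ideal which contains a nonzero polynomial in one variable is the unit
    ideal as soon as it becomes so on each plane where this variable is constant. *)
Lemma unit_of_fibres I i (r : {poly K}) : ideal I -> r != 0 -> I (emb i r) ->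
  (forall z, adjoin I ('X_i - z%:MP) 1) -> I 1.
Proof.
move=> [ID IM] r0; have [rs ->] := emb_factor i r => Ir fib.
have : I (\prod_(z <- rs) ('X_i - z%:MP)).
  have := IM (lead_coef r)^-1%:MP _ Ir.
  by rewrite mulrA -mpolyCM mulVf ?lead_coef_eq0 // mpolyC1 mul1r.
elim: rs {Ir} => [|z rs IH]; first by rewrite big_nil.
rewrite big_cons => Iz; apply: IH; set p := \prod_(_ <- _) _ in Iz *.
have [h Ih] := fib z.
have -> : p = p * (1 - h * ('X_i - z%:MP)) + h * (('X_i - z%:MP) * p) by ring.
by apply: ID; apply: IM.
Qed.

End Ideals.

Section SmoothCubic.
Variable K : numClosedFieldType.
Local Notation P := {mpoly K[3]}.
Variables k A B C : K.
Local Notation F := (cubic k A B C).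
Local Notation X := ('X_i1 : P).
Local Notation Y := ('X_i2 : P).
Local Notation Z := ('X_i3 : P).

Definition tjurina_ideal p := exists s t u v,
  p = s * F + t * F^`M(i1) + u * F^`M(i2) + v * F^`M(i3).

Lemma tjurina_idealP : ideal tjurina_ideal.
Proof.
split=> [p q [s [t [u [v ->]]]] [s' [t' [u' [v' ->]]]]|p q [s [t [u [v ->]]]]].
  by exists (s + s'), (t + t'), (u + u'), (v + v'); ring.
by exists (p * s), (p * t), (p * u), (p * v); ring.
Qed.

Lemma eval_diff (x : 'I_3 -> K) (I : P -> Prop) : ideal I ->
  (forall i, I ('X_i - (x i)%:MP)) -> forall p, I (p - p.@[x]%:MP).
Proof.
move=> [ID IM] Ix; have I0 : I 0 by have := IM 0 _ (Ix 0); rewrite mul0r.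
elim/mpoly_alg_ind => [r|i|p q Ip Iq|p q Ip Iq].
- by rewrite mevalC subrr.
- by rewrite mevalXU.
- by rewrite mevalD mpolyCD opprD addrACA; apply: ID.
rewrite mevalM mpolyCM.
have -> : p * q - p.@[x]%:MP * q.@[x]%:MP =
  q * (p - p.@[x]%:MP) + p.@[x]%:MP * (q - q.@[x]%:MP) by ring.
by apply: ID; apply: IM.
Qed.

(** The Nullstellensatz for the ideal generated by F and its partial derivatives.
    It contains a quintic in y and one in x, and F_z determines z, so it suffices
    to work at the points (x0, y0, z0), where smoothness gives an element with
    nonzero value. *)
Lemma smooth_unit : smooth_hypersurface F -> exists s t u v,
  1 = s * F + t * F^`M(i1) + u * F^`M(i2) + v * F^`M(i3).
Proof.
move=> smF; have [TD TM] := tjurina_idealP.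
have T0 : tjurina_ideal F by exists 1, 0, 0, 0; ring.
have T1 : tjurina_ideal F^`M(i1) by exists 0, 1, 0, 0; ring.
have T2 : tjurina_ideal F^`M(i2) by exists 0, 0, 1, 0; ring.
have T3 : tjurina_ideal F^`M(i3) by exists 0, 0, 0, 1; ring.
have Tf : tjurina_ideal (elim_f A%:MP C%:MP X Y).
  have -> : elim_f A%:MP C%:MP X Y = 2 * F^`M(i1) + - Y * F^`M(i3).
    by rewrite /elim_f cubicx cubicz; ring.
  by apply: TD; apply: TM.
have Tg : tjurina_ideal (elim_f B%:MP C%:MP Y X).
  have -> : elim_f B%:MP C%:MP Y X = 2 * F^`M(i2) + - X * F^`M(i3).
    by rewrite /elim_f cubicy cubicz; ring.
  by apply: TD; apply: TM.
have Ty : tjurina_ideal (emb i2 (quintic A B C)).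
  by have [u [v ->]] := emb_quintic i1 i2 A B C; apply: TD; apply: TM.
have Tx : tjurina_ideal (emb i1 (quintic B A C)).
  by have [u [v ->]] := emb_quintic i2 i1 B A C; apply: TD; apply: TM.
apply: (unit_of_fibres tjurina_idealP (quintic_neq0 A B C) Ty) => y0.
set J1 := adjoin _ _; have J1P : ideal J1 by apply/adjoin_ideal/tjurina_idealP.
apply: (unit_of_fibres J1P (quintic_neq0 B A C) (sub_adjoin _ Tx)) => x0.
set J := adjoin _ _; have [JD JM] : ideal J by apply: adjoin_ideal.
have TJ p : tjurina_ideal p -> J p by move=> Tp; do 2!apply: sub_adjoin.
have JT0 : tjurina_ideal 0 by have := TM 0 _ T0; rewrite mul0r.
have Jx : J (X - x0%:MP) by apply: mem_adjoin => //; apply: sub_adjoin.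
have Jy : J (Y - y0%:MP) by apply/sub_adjoin/mem_adjoin => //; apply: tjurina_idealP.
pose z0 := C - x0 * y0 / 2.
have Jz : J (Z - z0%:MP).
  have half2 : 2 * (2^-1)%:MP = 1 :> P := mulC_natV K 1.
  have -> : Z - z0%:MP = - (2^-1)%:MP * F^`M(i3) + (- (2^-1)%:MP * Y * (X - x0%:MP)
      + - (2^-1)%:MP * x0%:MP * (Y - y0%:MP)).
    rewrite cubicz /z0 mpolyCB !mpolyCM.
    transitivity (2 * (2^-1)%:MP * Z
      - (2 * (2^-1)%:MP * C%:MP - x0%:MP * y0%:MP * (2^-1)%:MP)).
      by rewrite half2 !mul1r.
    by ring.
  by apply: (JD); [apply/JM/TJ|apply: (JD); apply: JM].
pose x (i : 'I_3) := nth 0 [:: x0; y0; z0] i.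
have Jev : forall p, J (p - p.@[x]%:MP).
  apply: eval_diff => // i; case: i => [[|[|[|//]]]] hi.
  - by rewrite (_ : Ordinal hi = i1) //; apply/val_inj.
  - by rewrite (_ : Ordinal hi = i2) //; apply/val_inj.
  - by rewrite (_ : Ordinal hi = i3) //; apply/val_inj.
have J1x p : tjurina_ideal p -> p.@[x] != 0 -> J 1.
  move=> Tp p0; have -> : 1 = (p.@[x]^-1)%:MP * (p - 1 * (p - p.@[x]%:MP)).
    by rewrite mul1r opprB addrC subrK -mpolyCM mulVf // mpolyC1.
  by apply: (JM); rewrite -mulNr; apply: (JD); [apply: TJ|apply: (JM)].
have [F0|] := eqVneq F.@[x] 0; last exact: J1x.
case: (smF x F0) => i; apply: J1x.
case: i => [[|[|[|//]]]] hi.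
- by rewrite (_ : Ordinal hi = i1) //; apply/val_inj.
- by rewrite (_ : Ordinal hi = i2) //; apply/val_inj.
- by rewrite (_ : Ordinal hi = i3) //; apply/val_inj.
Qed.

End SmoothCubic.

(** * Differential forms on a surface in affine three-space *)

Section HdRBasis.
Variables (k : comNzRingType) (A : comAlgType k) (p n : nat) (w : 'I_n -> Omega A p.+1).
Hypothesis closed_w : forall i, dR (w i) = 0.
Hypothesis free_w : forall c (v : Omega A p), \sum_i c i *: w i = dR v -> forall i, c i = 0.
Hypothesis span_w : forall v, exists (c : 'I_n -> k) (u : Omega A p),
  v = \sum_i c i *: w i + dR u.

Lemma HdR_basis (cw : forall i, w i \in closed_form A p.+1) :
  is_basis (fun i => HdR_class (cw i)).
Proof.
have combE c : \sum_i c i *: HdR_class (cw i) =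
    lquot_pi (exact_submodule A p.+1) (\sum_i c i *: Cocycle (cw i)).
  by rewrite linear_sum; apply: eq_bigr => i _; rewrite linearZ.
have valE c : cocycle_form (\sum_i c i *: Cocycle (cw i)) = \sum_i c i *: w i.
  rewrite -[cocycle_form _]/(\val _) raddf_sum; apply: eq_bigr => i _.
  exact: GRing.valZ.
split=> [c|v].
  rewrite combE -(raddf0 (lquot_pi (exact_submodule A p.+1))) => /lquot_piP.
  by rewrite subr0 => /asboolP[v]; rewrite valE => /free_w.
rewrite -[v]lquot_piK; case: (repr v) => z cz.
have [c [u Ez]] := span_w z; exists c; rewrite combE; apply/lquot_piP/asboolP; exists u.
rewrite -[LHS]/(\val _) raddfB /= valE Ez.
by rewrite addrC addKr.
Qed.

End HdRBasis.

Section SurfaceForms.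
Variables (K : numFieldType) (A : comAlgType K).
Local Notation P := {mpoly K[3]}.
Variable pi : {lrmorphism P -> A}.
Variable F : P.
Hypothesis pi_onto : forall x, exists p, x = pi p.
Hypothesis pi_ker : forall p, pi p = 0 <-> exists q, p = F * q.

Local Notation X := ('X_i1 : P).
Local Notation Y := ('X_i2 : P).
Local Notation Z := ('X_i3 : P).
Implicit Types p q r a b c u v w : P.

Lemma pi_F : pi F = 0.
Proof. by apply/pi_ker; exists 1; rewrite mulr1. Qed.

Lemma pi_mulF p : pi (F * p) = 0.
Proof. by rewrite rmorphM /= pi_F mul0r. Qed.

Lemma dform0 n (s : n.-tuple A) : dform 0 s = 0.
Proof. by have := @Defs.formZl _ _ _ 0 0 s; rewrite !scale0r. Qed.

Lemma dformN n x (s : n.-tuple A) : dform (- x) s = - dform x s.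
Proof. by have := @Defs.formZl _ _ _ (-1) x s; rewrite !scaleN1r. Qed.

(** The chain rule in one entry of a form. *)
Lemma dform_chain n x (s : n.-tuple A) i p :
  dform x (tupd s i (pi p)) =
  \sum_(j < 3) dform (x * pi p^`M(j)) (tupd s i (pi 'X_j)).
Proof.
elim/mpoly_alg_ind: p x => [r|j|p q IHp IHq|p q IHp IHq] x.
- have -> : pi r%:MP = r%:A by rewrite -[r%:MP]mulr1 mul_mpolyC linearZ rmorph1.
  by rewrite Defs.formC big1 // => j _; rewrite mderivC rmorph0 mulr0 dform0.
- rewrite (bigD1 j) //= mderivXU eqxx mpolyC1 rmorph1 mulr1 big1 ?addr0 // => l lj.
  by rewrite mderivXU eq_sym (negPf lj) mpolyC0 rmorph0 mulr0 dform0.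
- rewrite rmorphD Defs.formD IHp IHq -big_split; apply: eq_bigr => j _ /=.
  by rewrite mderivD rmorphD mulrDr Defs.formDl.
rewrite rmorphM Defs.formM IHp IHq -big_split; apply: eq_bigr => j _ /=.
rewrite -Defs.formDl mderivM rmorphD !rmorphM; congr (dform _ _).
by rewrite mulrDr addrC; congr (_ + _); rewrite -!mulrA // [pi q * _]mulrC.
Qed.

Lemma tupd2 (y z t : A) : ((tupd [tuple y; z] ord0 t = [tuple t; z]) *
  (tupd [tuple y; z] (fintype.lift ord0 ord0) t = [tuple y; t]))%type.
Proof.
by split; apply: eq_from_tnth => i; rewrite tnth_mktuple; case: i => [[|[|//]]] hi.
Qed.

Lemma sum3 (V : zmodType) (f : 'I_3 -> V) : \sum_i f i = f i1 + f i2 + f i3.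
Proof.
rewrite !big_ord_recl big_ord0 addr0 addrA.
by congr (f _ + f _ + f _); apply/val_inj.
Qed.

Definition coords : 3.-tuple A := [tuple pi 'X_j | j < 3].

Lemma coordsE : coords = [tuple pi X; pi Y; pi Z].
Proof.
apply: eq_from_tnth => i; rewrite tnth_mktuple; case: i => [[|[|[|//]]]] hi;
by congr (pi 'X__); apply/val_inj.
Qed.

Lemma dform_chain_coords x i p :
  dform x (tupd coords i (pi p)) = dform (x * pi p^`M(i)) coords.
Proof.
rewrite dform_chain (bigD1 i) //= big1 ?addr0 => [|j ji].
  congr (dform _ _); apply: eq_from_tnth => j; rewrite !tnth_mktuple.
  by case: eqVneq => // ->.
apply: (form_alt _ (i := i) (j := j)); first by rewrite eq_sym.
by rewrite !tnth_mktuple eqxx (negPf ji).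
Qed.

(** Replacing one coordinate by F in dx dy dz gives zero since dF = 0 on the
    surface, and gives the corresponding partial derivative times dx dy dz by the
    chain rule. *)
Lemma volume_form0 x : (exists s t u v,
  1 = s * F + t * F^`M(i1) + u * F^`M(i2) + v * F^`M(i3)) -> dform x coords = 0.
Proof.
have grad0 y i : dform (y * pi F^`M(i)) coords = 0.
  by rewrite -dform_chain_coords pi_F -(scale0r 1) Defs.formC.
case=> s [t [u [v /(congr1 pi)]]].
rewrite rmorph1 !rmorphD !rmorphM /= pi_F mulr0 add0r => E.
by rewrite -[x]mulr1 E !mulrDr !mulrA !Defs.formDl !grad0 !addr0.
Qed.

Lemma dR_dydz p : dR (dform (pi p) [tuple pi Y; pi Z]) = dform (pi p^`M(i1)) coords.
Proof.
rewrite dR_dform -[pi p^`M(_)]mul1r -dform_chain_coords coordsE; congr (dform _ _).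
by rewrite (cons_tupd0 _ _ (pi X)); congr (tupd _ _ _); apply/val_inj.
Qed.

(** The contraction of the volume form with the vector field (a, b, c). *)
Definition two_form a b c : Omega A 2 :=
  dform (pi a) [tuple pi Y; pi Z] + dform (pi b) [tuple pi Z; pi X]
  + dform (pi c) [tuple pi X; pi Y].

Lemma two_formD a b c a' b' c' :
  two_form (a + a') (b + b') (c + c') = two_form a b c + two_form a' b' c'.
Proof.
rewrite /two_form !rmorphD !Defs.formDl.
by rewrite [RHS]addrACA; congr (_ + _); apply: addrACA.
Qed.

Lemma two_formZ (l : K) a b c : two_form (l *: a) (l *: b) (l *: c) = l *: two_form a b c.
Proof. by rewrite /two_form !linearZ /= !Defs.formZl !scalerDr. Qed.

Lemma two_form_mulF a b c : two_form (F * a) (F * b) (F * c) = 0.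
Proof. by rewrite /two_form !pi_mulF !dform0 !addr0. Qed.

Lemma dform_diag x y : dform x [tuple y; y] = 0 :> Omega A 2.
Proof. exact: (form_alt _ (i := ord0) (j := fintype.lift ord0 ord0)). Qed.

Lemma dform_anti x y z : dform x [tuple y; z] = - dform x [tuple z; y] :> Omega A 2.
Proof.
have := form_swap x [tuple y; z] y z (isT : ord0 != fintype.lift ord0 ord0 :> 'I_2).
by rewrite !tupd2.
Qed.

Lemma dform_chain_l x y p :
  dform x [tuple pi p; y] = \sum_(j < 3) dform (x * pi p^`M(j)) [tuple pi 'X_j; y].
Proof.
have := dform_chain x [tuple 0; y] ord0 p; rewrite tupd2 => ->.
by apply: eq_bigr => j _; rewrite tupd2.
Qed.

Lemma dform_chain_r x y p :
  dform x [tuple y; pi p] = \sum_(j < 3) dform (x * pi p^`M(j)) [tuple y; pi 'X_j].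
Proof.
have := dform_chain x [tuple y; 0] (fintype.lift ord0 ord0) p; rewrite tupd2 => ->.
by apply: eq_bigr => j _; rewrite tupd2.
Qed.

(** The wedge product of dp with u dx + v dy + w dz is given by the cross product
    of grad p with (u, v, w). *)
Lemma wedge_d p u v w :
  dform (pi u) [tuple pi p; pi X] + dform (pi v) [tuple pi p; pi Y]
   + dform (pi w) [tuple pi p; pi Z] =
  two_form (p^`M(i2) * w - p^`M(i3) * v) (p^`M(i3) * u - p^`M(i1) * w)
    (p^`M(i1) * v - p^`M(i2) * u).
Proof.
rewrite !dform_chain_l !sum3 !dform_diag.
rewrite (dform_anti _ (pi Y) (pi X)) (dform_anti _ (pi X) (pi Z)).
rewrite (dform_anti _ (pi Z) (pi Y)).
rewrite /two_form !rmorphB !rmorphM /= !Defs.formDl !dformN.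
rewrite ![pi p^`M(_) * _]mulrC.
rewrite !addr0 add0r.
by rewrite [LHS](AC ((2*2)*2)%AC ((6*4)*(2*5)*(3*1))%AC).
Qed.

(** This is the wedge product with dF. *)
Lemma two_form_cross u v w :
  two_form (v * F^`M(i3) - w * F^`M(i2)) (w * F^`M(i1) - u * F^`M(i3))
    (u * F^`M(i2) - v * F^`M(i1)) = 0.
Proof.
have dF0 x y : dform x [tuple pi F; y] = 0 :> Omega A 2.
  have := Defs.formC x [tuple 0; y] ord0 (0 : K).
  by rewrite scale0r pi_F tupd2.
have := wedge_d F (- u) (- v) (- w); rewrite !dF0 !addr0 => /esym.
by rewrite !mulrN !opprK ![- (_ * _) + _]addrC ![F^`M(_) * _]mulrC.
Qed.

Lemma two_form_curl u v w :
  two_form (w^`M(i2) - v^`M(i3)) (u^`M(i3) - w^`M(i1)) (v^`M(i1) - u^`M(i2)) =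
  dR (dform (pi u) [tuple pi X] + dform (pi v) [tuple pi Y] + dform (pi w) [tuple pi Z]).
Proof.
rewrite !raddfD /= !dR_dform.
have d0 x y : dform (pi 0) [tuple x; y] = 0 :> Omega A 2 by rewrite rmorph0 dform0.
have := wedge_d u 1 0 0; have := wedge_d v 0 1 0; have := wedge_d w 0 0 1.
rewrite !d0 !addr0 !add0r rmorph1 => -> -> ->; rewrite -!two_formD.
by congr two_form; ring.
Qed.

Lemma pair_tuple (s : 2.-tuple A) : exists p q, s = [tuple pi p; pi q].
Proof.
have [p Ep] := pi_onto (tnth s ord0).
have [q Eq] := pi_onto (tnth s (fintype.lift ord0 ord0)).
exists p, q; rewrite -Ep -Eq; apply: eq_from_tnth => i.
by case: i => [[|[|//]]] hi; rewrite !(tnth_nth 0).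
Qed.

Lemma two_form_onto (x : Omega A 2) : exists a b c, x = two_form a b c.
Proof.
pose Q x := exists a b c, x = two_form a b c.
have QD y z : Q y -> Q z -> Q (y + z).
  move=> [a [b [c ->]]] [a' [b' [c' ->]]].
  by exists (a + a'), (b + b'), (c + c'); rewrite two_formD.
have QZ l y : Q y -> Q (l *: y).
  by move=> [a [b [c ->]]]; exists (l *: a), (l *: b), (l *: c); rewrite two_formZ.
have Q0 : Q 0 by exists (F * 0), (F * 0), (F * 0); rewrite two_form_mulF.
rewrite -/(Q x) -[x]lquot_piK; elim/preform_ind: (repr x) => [y s|l y z Qy Qz]; last first.
  by rewrite linearP; apply: QD => //; apply: QZ.
rewrite -/(dform y s).
have [p [q ->]] := pair_tuple s; have [r ->] := pi_onto y.
rewrite dform_chain_l; apply: (big_ind Q) => // i _.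
rewrite dform_chain_r; apply: (big_ind Q) => // j _.
rewrite -!rmorphM; move: (r * _ * _) => a.
have d0 x' y' : dform (pi 0) [tuple x'; y'] = 0 :> Omega A 2 by rewrite rmorph0 dform0.
have [Q1 Q2 Q3] : [/\ Q (dform (pi a) [tuple pi Y; pi Z]),
    Q (dform (pi a) [tuple pi Z; pi X]) & Q (dform (pi a) [tuple pi X; pi Y])].
  split; [exists a, 0, 0|exists 0, a, 0|exists 0, 0, a];
  by rewrite /two_form !d0 ?addr0 ?add0r.
have QN y' z' : Q (dform (pi a) [tuple y'; z']) -> Q (dform (pi a) [tuple z'; y']).
  by rewrite dform_anti -scaleN1r => /(QZ (-1)); rewrite scalerA mulrNN mulr1 scale1r.
have -> : dform (pi a) [tuple pi 'X_i; pi 'X_j] =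
    dform (pi a) [tuple tnth coords i; tnth coords j].
  by rewrite !tnth_mktuple.
rewrite coordsE.
case: i => [[|[|[|//]]]] hi; case: j => [[|[|[|//]]]] hj; rewrite !(tnth_nth 0) /=;
  by rewrite ?dform_diag //; apply: QN.
Qed.


(** If div w = div (g, 0, 0) + div(q x grad F) + div(F w'), then
    w - (g, 0, 0) - q x grad F - F w' is a curl; hence the two-form of w is
    g dy dz plus an exact form. *)
Lemma two_form_span n (f : 'I_n -> P) :
  (forall p, exists (k : 'I_n -> K) u v w a b c,
     p = \sum_i k i *: (f i)^`M(i1) + curl_along F u v w + div (F * a) (F * b) (F * c)) ->
  forall x, exists (k : 'I_n -> K) y,
    x = \sum_i k i *: dform (pi (f i)) [tuple pi Y; pi Z] + dR y.
Proof.
move=> span x; have [a [b [c ->]]] := two_form_onto x.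
have [k [u [v [w [a' [b' [c' E]]]]]]] := span (div a b c).
pose g := \sum_i k i *: f i.
have [|r1 [r2 [r3 [Ea Eb Ec]]]] := @div0_curl K
  (a - g - (v * F^`M(i3) - w * F^`M(i2)) - F * a')
  (b - 0 - (w * F^`M(i1) - u * F^`M(i3)) - F * b')
  (c - 0 - (u * F^`M(i2) - v * F^`M(i1)) - F * c').
  have dg : g^`M(i1) = \sum_i k i *: (f i)^`M(i1).
    by rewrite raddf_sum; apply: eq_bigr => i _; rewrite /= mderivZ.
  move: E; rewrite -div_cross -dg /div => E.
  move/eqP: E; rewrite -subr_eq0 => /eqP E0; rewrite -[RHS]E0 !mderivB mderiv0.
  by ring.
exists k, (dform (pi r1) [tuple pi X] + dform (pi r2) [tuple pi Y]
  + dform (pi r3) [tuple pi Z]).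
have -> : \sum_i k i *: dform (pi (f i)) [tuple pi Y; pi Z] = two_form g 0 0.
  rewrite /two_form rmorph0 !dform0 !addr0 /g.
  pose d1 := fun q => dform (pi q) [tuple pi Y; pi Z].
  have d1D : {morph d1 : p q / p + q} by move=> p q; rewrite /d1 rmorphD Defs.formDl.
  have d10 : d1 0 = 0 by rewrite /d1 rmorph0 dform0.
  rewrite -[RHS]/(d1 _) (big_morph d1 d1D d10); apply: eq_bigr => i _.
  by rewrite /d1 linearZ /= Defs.formZl.
rewrite -two_form_curl -Ea -Eb -Ec.
rewrite -[RHS]addr0 -(two_form_cross u v w) -[RHS]addr0 -(two_form_mulF a' b' c').
by rewrite -!two_formD; congr two_form; ring.
Qed.

(** The divergence of the field a (grad p x grad q), which represents the two-form
    a dp dq. *)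
Definition form_div a p q : P :=
  div (a * (p^`M(i2) * q^`M(i3) - p^`M(i3) * q^`M(i2)))
      (a * (p^`M(i3) * q^`M(i1) - p^`M(i1) * q^`M(i3)))
      (a * (p^`M(i1) * q^`M(i2) - p^`M(i2) * q^`M(i1))).

(** The divergences of the fields whose two-form vanishes on the surface. *)
Definition zero_divergences : {pred P} := fun p => `[< exists u v w a b c,
  p = curl_along F u v w + div (F * a) (F * b) (F * c) >].

Lemma zero_divergences_closed : submod_closed zero_divergences.
Proof.
split=> [|l p q /asboolP[u [v [w [a [b [c ->]]]]]] /asboolP[u' [v' [w' [a' [b' [c' ->]]]]]]];
  apply/asboolP.
  exists 0, 0, 0, 0, 0, 0.
  by rewrite /curl_along /along /div !mulr0 !mderiv0 !subr0 !mulr0 !addr0.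
exists (l *: u + u'), (l *: v + v'), (l *: w + w').
exists (l *: a + a'), (l *: b + b'), (l *: c + c').
by rewrite curl_alongP !mulrDr -!scalerAr divP scalerDr addrACA.
Qed.

Definition divergence_quot := lquot (Submodule zero_divergences_closed).
HB.instance Definition _ := GRing.Lmodule.on divergence_quot.
Definition dclass : {linear P -> divergence_quot} :=
  lquot_pi (Submodule zero_divergences_closed).

Lemma dclassP p q : dclass p = dclass q <->
  exists u v w a b c, p - q = curl_along F u v w + div (F * a) (F * b) (F * c).
Proof. by split=> [/lquot_piP/asboolP|h]; [|apply/lquot_piP/asboolP]. Qed.

Lemma form_div_lift_coef a a' p q : pi a = pi a' ->
  dclass (form_div a p q) = dclass (form_div a' p q).
Proof.
move/eqP; rewrite -subr_eq0 -rmorphB => /eqP/pi_ker[h E]; apply/dclassP.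
exists 0, 0, 0, (h * (p^`M(i2) * q^`M(i3) - p^`M(i3) * q^`M(i2))),
  (h * (p^`M(i3) * q^`M(i1) - p^`M(i1) * q^`M(i3))),
  (h * (p^`M(i1) * q^`M(i2) - p^`M(i2) * q^`M(i1))).
rewrite !mulrA -E /form_div /curl_along /along /div !mderiv0 !mulrBl !mderivB; by ring.
Qed.

Lemma divD a b c a' b' c' : div (a + a') (b + b') (c + c') = div a b c + div a' b' c'.
Proof. by rewrite /div !mderivD; ring. Qed.

Lemma form_div_anti a p q : form_div a p q = - form_div a q p.
Proof. by rewrite /form_div /div !mderivM !mderivB !mderivM; ring. Qed.

(** If p - p' = F h, then a dp dq changes by F a dh dq and by a h dF dq, whose
    field is a cross product with grad F. *)
Lemma form_div_lift_l a p p' q : pi p = pi p' ->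
  dclass (form_div a p q) = dclass (form_div a p' q).
Proof.
move/eqP; rewrite -subr_eq0 -rmorphB => /eqP/pi_ker[h E]; apply/dclassP.
exists (- (a * h * q^`M(i1))), (- (a * h * q^`M(i2))), (- (a * h * q^`M(i3))),
  (a * (h^`M(i2) * q^`M(i3) - h^`M(i3) * q^`M(i2))),
  (a * (h^`M(i3) * q^`M(i1) - h^`M(i1) * q^`M(i3))),
  (a * (h^`M(i1) * q^`M(i2) - h^`M(i2) * q^`M(i1))).
have -> : p = p' + F * h by rewrite -E addrC subrK.
rewrite -div_cross /form_div !mderivD ![(F * h)^`M(_)]mderivM.
by apply/eqP; rewrite subr_eq; apply/eqP; rewrite -!divD; congr div; ring.
Qed.

Lemma form_div_lift a a' p p' q q' : pi a = pi a' -> pi p = pi p' -> pi q = pi q' ->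
  dclass (form_div a p q) = dclass (form_div a' p' q').
Proof.
move=> ea ep eq; rewrite (form_div_lift_coef _ _ ea) (form_div_lift_l _ _ ep).
by rewrite form_div_anti [in RHS]form_div_anti !linearN (form_div_lift_l _ _ eq).
Qed.

(** By [form_div_lift] the choice of the lift has no influence on the divergence of
    a form, which is why the map below respects the relations between forms. *)
Definition lift_poly (x : A) : P := sval (cid (pi_onto x)).
Lemma lift_polyK x : pi (lift_poly x) = x.
Proof. by rewrite /lift_poly; case: cid. Qed.

Definition gen_divergence (g : A * 2.-tuple A) : divergence_quot :=
  dclass (form_div (lift_poly g.1) (lift_poly (tnth g.2 0)) (lift_poly (tnth g.2 1))).

Lemma gen_divergenceE a p q :
  gen_divergence (pi a, [tuple pi p; pi q]) = dclass (form_div a p q).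
Proof. by apply: form_div_lift; rewrite lift_polyK. Qed.

Definition preform_divergence (x : preform A 2) : divergence_quot :=
  fglift gen_divergence x.

Lemma preform_divergence_gen y s : preform_divergence (gen y s) = gen_divergence (y, s).
Proof. by rewrite /preform_divergence liftU scale1r. Qed.

Lemma preform_divergence_zmod : zmod_morphism preform_divergence.
Proof. exact: lift_is_additive. Qed.
HB.instance Definition _ := GRing.isZmodMorphism.Build (preform A 2) divergence_quot
  preform_divergence preform_divergence_zmod.

Lemma preform_divergenceZ l x : preform_divergence (l *: x) = l *: preform_divergence x.
Proof.
elim/freeg_ind_dom0: x => [|c g D _ _ IH]; first by rewrite scaler0 !raddf0 ?scaler0.
have pD y z : preform_divergence (y + z) = preform_divergence y + preform_divergence z.
  exact: raddfD.
rewrite scalerDr !pD IH scalerDr; congr (_ + _).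
have -> : l *: << c *g g >> = << l * c *g g >> :> preform A 2.
  by apply/eqP/freeg_eqP => y; rewrite coeffZ !coeffU mulrA.
by rewrite /preform_divergence !liftU scalerA.
Qed.

Lemma preform_divergence_rel x : form_rel x -> preform_divergence x = 0.
Proof.
have ord2 (i : 'I_2) : i = ord0 \/ i = fintype.lift ord0 ord0.
  by case: i => [[|[|//]]] hi; [left|right]; apply/val_inj.
have eq_class u v : u = v -> dclass (u - v) = 0 by move=> ->; rewrite subrr raddf0.
case=> {x} [x x' s|l x s|x s i y z|x s i y z|x s i l|x s i j ij e].
- have [a ->] := pi_onto x; have [b ->] := pi_onto x'; have [p [q ->]] := pair_tuple s.
  rewrite raddfB raddfD /= !preform_divergence_gen -rmorphD !gen_divergenceE -raddfD -raddfB.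
  by apply: eq_class; rewrite /form_div -divD; congr div; ring.
- have [a ->] := pi_onto x; have [p [q ->]] := pair_tuple s.
  rewrite raddfB /= preform_divergenceZ !preform_divergence_gen -linearZ !gen_divergenceE.
  rewrite -linearZ -raddfB; apply: eq_class.
  by rewrite /form_div /div !scalerDr -!mderivZ -!mul_mpolyC !mulrA.
- have [a ->] := pi_onto x; have [p [q ->]] := pair_tuple s.
  have [b ->] := pi_onto y; have [c ->] := pi_onto z.
  rewrite raddfB raddfD /= !preform_divergence_gen -rmorphD.
  by case: (ord2 i) => ->; rewrite !tupd2 !gen_divergenceE -raddfD -raddfB; apply: eq_class;
    rewrite /form_div -divD !mderivD; congr div; ring.
- have [a ->] := pi_onto x; have [p [q ->]] := pair_tuple s.
  have [b ->] := pi_onto y; have [c ->] := pi_onto z.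
  rewrite raddfB raddfD /= !preform_divergence_gen -!rmorphM.
  by case: (ord2 i) => ->; rewrite !tupd2 !gen_divergenceE -raddfD -raddfB; apply: eq_class;
    rewrite /form_div -divD !mderivM; congr div; ring.
- have [a ->] := pi_onto x; have [p [q ->]] := pair_tuple s.
  have -> : l%:A = pi l%:MP by rewrite -[l%:MP]mulr1 mul_mpolyC linearZ rmorph1.
  rewrite preform_divergence_gen.
  by case: (ord2 i) => ->; rewrite !tupd2 gen_divergenceE /form_div !mderivC !(mul0r, mulr0)
    !subr0 !mulr0 /div !mderiv0 !addr0 raddf0.
have [a ->] := pi_onto x; have [p [q Es]] := pair_tuple s.
have Epq : pi p = pi q.
  by case: (ord2 i) ij e => ->; case: (ord2 j) => -> //; rewrite Es !(tnth_nth 0).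
rewrite preform_divergence_gen Es Epq gen_divergenceE -[form_div _ _ _]subr0; apply: eq_class.
rewrite /form_div (_ : 0 = div 0 0 0); last by rewrite /div !mderiv0 !addr0.
by congr div; ring.
Qed.

Definition divergence (x : Omega A 2) : divergence_quot := preform_divergence (repr x).

Lemma divergence_pi x :
  divergence (lquot_pi (lspan (@form_rel K A 2)) x) = preform_divergence x.
Proof.
apply/eqP; rewrite -subr_eq0 -raddfB; apply/eqP.
have /lspanP[n [c [g [rg ->]]]] := lquot_pi_repr (lspan (@form_rel K A 2)) x.
rewrite raddf_sum big1 // => i _ /=.
by rewrite preform_divergenceZ preform_divergence_rel // scaler0.
Qed.

Lemma divergence_linear : linear divergence.
Proof.
move=> l x y; rewrite -[x]lquot_piK -[y]lquot_piK -linearP !divergence_pi raddfD /=.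
by rewrite preform_divergenceZ.
Qed.
HB.instance Definition _ := GRing.isLinear.Build K (Omega A 2) divergence_quot *:%R
  divergence divergence_linear.

Lemma divergence_dform a p q :
  divergence (dform (pi a) [tuple pi p; pi q]) = dclass (form_div a p q).
Proof. by rewrite divergence_pi preform_divergence_gen gen_divergenceE. Qed.

(** The field grad p x grad q is the curl of p grad q. *)
Lemma divergence_dR (y : Omega A 1) : divergence (dR y) = 0.
Proof.
rewrite -[y]lquot_piK; elim/preform_ind: (repr y) => [x s|l x z IHx IHz]; last first.
  by rewrite !linearP /= IHx IHz scaler0 addr0.
rewrite -/(dform x s) dR_dform; have [p ->] := pi_onto x.
have [q Eq] := pi_onto (tnth s ord0).
have -> : [tuple of pi p :: s] = [tuple pi p; pi q].
  apply: eq_from_tnth => i; rewrite -Eq.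
  by case: i => [[|[|//]]] hi; rewrite !(tnth_nth 0).
rewrite -(rmorph1 pi) divergence_dform (_ : form_div _ _ _ = 0) ?raddf0 //.
rewrite /form_div /div !mul1r !mderivB !mderivM.
by rewrite (mderiv_comm i1 i2 p) (mderiv_comm i1 i3 p) (mderiv_comm i2 i3 p)
  (mderiv_comm i1 i2 q) (mderiv_comm i1 i3 q) (mderiv_comm i2 i3 q); ring.
Qed.

(** The divergence kills exact forms and sends f dy dz to the derivative of f
    along x. *)
Lemma two_form_free n (f : 'I_n -> P) :
  (forall (k : 'I_n -> K) u v w a b c,
     \sum_i k i *: (f i)^`M(i1) = curl_along F u v w + div (F * a) (F * b) (F * c) ->
     forall i, k i = 0) ->
  forall k (y : Omega A 1),
    \sum_i k i *: dform (pi (f i)) [tuple pi Y; pi Z] = dR y -> forall i, k i = 0.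
Proof.
move=> free k y /(congr1 divergence); rewrite divergence_dR linear_sum.
rewrite (eq_bigr (fun i => dclass (k i *: (f i)^`M(i1)))) => [|i _]; last first.
  rewrite !linearZ /= divergence_dform; congr (_ *: dclass _).
  rewrite /form_div !mderivXU !axesE mpolyC0 mpolyC1 /div.
  by rewrite !(mulr0, mulr1, mul0r) !subr0 ?mulr1 !mulr0 !mderiv0 !addr0.
rewrite -linear_sum -(raddf0 dclass) => /dclassP[u [v [w [a [b [c]]]]]].
by rewrite subr0; apply: free.
Qed.

End SurfaceForms.

(** * The second cohomology of the cubic surface *)

Section CubicForms.
Variables (K : numClosedFieldType) (k A B C : K).
Local Notation P := {mpoly K[3]}.
Local Notation F := (cubic k A B C).
Local Notation X := ('X_i1 : P).
Local Notation Y := ('X_i2 : P).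
Local Notation Z := ('X_i3 : P).

Definition form_coef (i : 'I_5) : P := nth 0 [:: X; X ^+ 2; X * Y; X * Z; X ^+ 3] i.

Lemma sum5 (V : zmodType) (f : 'I_5 -> V) :
  \sum_i f i = f 0 + f 1 + f 2 + f 3 + f 4.
Proof.
rewrite !big_ord_recl big_ord0 addr0 !addrA.
by congr (f _ + f _ + f _ + f _ + f _); apply/val_inj.
Qed.

Lemma divC_mul (r : K) n (p : P) : (r / n.+1%:R)%:MP * (n.+1%:R * p) = r%:MP * p.
Proof. by rewrite mulrA -mpolyC_nat -mpolyCM divfK ?pnatr_eq0. Qed.

Lemma form_coef_sum (s : 'I_5 -> K) : \sum_i s i *: (form_coef i)^`M(i1) =
  (s 0)%:MP + (s 1)%:MP * (2 * X) + (s 2)%:MP * Y + (s 3)%:MP * Z + (s 4)%:MP * (3 * X * X).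
Proof.
rewrite sum5 /form_coef /= -!mul_mpolyC !expr2 exprS expr2.
by rewrite !mderivM !mderivXU !axesE mpolyC0 mpolyC1; ring.
Qed.

(** The derivatives 1, 2x, y, z, 3x^2 and the basis 1, x, y, z, x^2 - Ax - 2 have
    the same span. *)
Lemma cubic_form_span p : exists (s : 'I_5 -> K) u v w a b c,
  p = \sum_i s i *: (form_coef i)^`M(i1) + curl_along F u v w + div (F * a) (F * b) (F * c).
Proof.
have [s [u [v [w [a [b [c ->]]]]]]] := divergence_span (@cubic_basis_gen K k A B C)
  (@mul_cubic_basis K k A B C) (@cubic_weight_neq0 K) p.
exists (fun i => nth 0 [:: s 0 - 2 * s 4; (s 1 - A * s 4) / 2; s 2; s 3; s 4 / 3] i).
exists u, v, w, a, b, c; congr (_ + _ + _).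
rewrite form_coef_sum sum5 /cubic_basis /= -!mul_mpolyC.
rewrite -!mulrA !divC_mul.
by rewrite !(mpolyCB, mpolyCM, mpolyC_nat); ring.
Qed.

Lemma cubic_form_free (s : 'I_5 -> K) u v w a b c :
  \sum_i s i *: (form_coef i)^`M(i1) = curl_along F u v w + div (F * a) (F * b) (F * c) ->
  forall i, s i = 0.
Proof.
pose t (i : 'I_5) := nth 0 [:: s 0 + 6 * s 4; 2 * s 1 + 3 * A * s 4; s 2; s 3; 3 * s 4] i.
have -> : \sum_i s i *: (form_coef i)^`M(i1) = \sum_i t i *: cubic_basis A i.
  rewrite form_coef_sum sum5 /t /cubic_basis /= -!mul_mpolyC.
  by rewrite !(mpolyCD, mpolyCM, mpolyC_nat); ring.
move=> /(divergence_free (@cubic_koszul K k A B C) (@cubic_basis_gen K k A B C)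
  (@cubic_basis_free K k A B C) (@mul_cubic_basis K k A B C) (@cubic_weight_neq0 K)) t0.
have s4 : s 4 = 0.
  by have /eqP := t0 4; rewrite /t /= mulf_eq0 pnatr_eq0 => /eqP.
have s3 : s 3 = 0 := t0 3.
have s2 : s 2 = 0 := t0 2.
have s1 : s 1 = 0.
  by have /eqP := t0 1; rewrite /t /= s4 mulr0 addr0 mulf_eq0 pnatr_eq0 => /eqP.
have s0 : s 0 = 0 by have := t0 0; rewrite /t /= s4 mulr0 addr0.
by case=> [[|[|[|[|[|//]]]]] hi]; [rewrite -[RHS]s0|rewrite -[RHS]s1|rewrite -[RHS]s2
  |rewrite -[RHS]s3|rewrite -[RHS]s4]; congr s; apply/val_inj.
Qed.

Variables (R : comAlgType K) (pi : {lrmorphism P -> R}).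
Hypothesis pi_onto : forall x, exists p, x = pi p.
Hypothesis pi_ker : forall p, pi p = 0 <-> exists q, p = F * q.

Lemma cubic_HdR (w : 'I_5 -> Omega R 2) :
  (forall i, w i = dform (pi (form_coef i)) [tuple pi Y; pi Z]) -> smooth_hypersurface F ->
  exists closed : forall i, w i \in closed_form R 2,
    is_basis (fun i => HdR_class (closed i)).
Proof.
move=> wE smF.
have closed_w i : dR (w i) = 0.
  by rewrite wE dR_dydz (volume_form0 pi_ker) //; apply: smooth_unit.
exists (fun i => introT (closed_formP (w i)) (closed_w i)).
apply: HdR_basis => // [s y|x].
  under eq_bigr do rewrite wE.
  by apply: (two_form_free pi_onto pi_ker) => {}s; apply: cubic_form_free.
have [s [y ->]] := two_form_span pi_onto pi_ker cubic_form_span x.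
by exists s, y; congr (_ + _); apply: eq_bigr => i _; rewrite wE.
Qed.

End CubicForms.

Theorem mainTheorem5 (R : realType) (b1 b2 b3 b4 : R[i]%C) :
  smooth_hypersurface (u4 b1 b2 b3 b4) ->
  has_dim (HdR (coordRing b1 b2 b3 b4) 2) 5 /\
  exists closed : forall i : 'I_5,
      tnth (fiveForms b1 b2 b3 b4) i \in closed_form (coordRing b1 b2 b3 b4) 2,
    is_basis (fun i : 'I_5 => HdR_class (closed i)).
Proof.
set k : R[i]%C := 4 - b1 ^+ 2 - b2 ^+ 2 - b3 ^+ 2 - b4 ^+ 2 - b1 * b2 * b3 * b4.
have uE : u4 b1 b2 b3 b4 =
    cubic k ((b1 * b2 + b3 * b4) / 2) ((b1 * b3 + b2 * b4) / 2) ((b2 * b3 + b1 * b4) / 2).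
  rewrite /u4 /cubic; have half (r : R[i]%C) : 2 * (r / 2) = r.
    by rewrite mulrC divfK // pnatr_eq0.
  by rewrite !half.
move=> smooth.
pose pi : {lrmorphism {mpoly R[i]%C[3]} -> coordRing b1 b2 b3 b4} :=
  @aquot_pi _ _ (u4_ideal b1 b2 b3 b4).
have pi_onto x : exists p, x = pi p by exists (repr x); rewrite /= aquot_piK.
have pi_ker p : pi p = 0 <-> exists q, p = u4 b1 b2 b3 b4 * q.
  rewrite -(raddf0 pi); split=> [/aquot_piP/asboolP[q]|[q ->]].
    by rewrite subr0 => ->; exists q; rewrite mulrC.
  by apply/aquot_piP/asboolP; exists q; rewrite subr0 mulrC.
have formE i : tnth (fiveForms b1 b2 b3 b4) i =
    dform (pi (form_coef _ i)) [tuple pi 'X_1; pi 'X_2].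
  case: i => [[|[|[|[|[|//]]]]] hi]; rewrite (tnth_nth 0) /form_coef /=;
  by congr (dform _ _); rewrite ?expr0 ?rmorphM ?rmorphXn.
rewrite uE in smooth pi_ker.
have [closed basis] := cubic_HdR pi_onto pi_ker formE smooth.
by split; [exists (fun i => HdR_class (closed i))|exists closed].
Qed.
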